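(* (1) If $(\mathbf{M},1,\otimes,\{\Phi_{(f',g'),(f,g)}\},\{\beta_{A,B}\},\{\beta_{f,g}\})$ is a quasistrict symmetric monoidal 2-category, then restricting to the underlying interchangor 2-isomorphisms $\phi_{f,g}:=\Phi_{(f,\mathrm{id}),(\mathrm{id},g)}$ gives a stringent symmetric monoidal 2-category $(\mathbf{M},1,\otimes,\{\phi_{f,g}\},\{\beta_{A,B}\})$. (2) If $(\mathbf{M},1,\otimes,\{\phi_{f,g}\},\{\beta_{A,B}\})$ is a stringent symmetric monoidal 2-category, then coherence isomorphisms $\beta_{f,g}$ can be introduced, and the interchangor 2-isomorphisms $\phi_{f,g}$ can be extended to coherence isomorphisms $\Phi_{(f',g'),(f,g)}$, so as to make $\mathbf{M}$ into a quasistrict symmetric monoidal 2-category. (3) The processes in (1) and (2) are inverse to each other, on the nose.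
   Context: Conventions. A 2-category is a strict bicategory. $\circ$ denotes composition of 1-morphisms and vertical composition of 2-morphisms, and $\ast$ denotes horizontal composition (whiskering). Cubical functor. For 2-categories $\mathbf{C},\mathbf{C}',\mathbf{D}$, a cubical functor $F\colon\mathbf{C}\times\mathbf{C}'\to\mathbf{D}$ is a pseudofunctor whose coherence isomorphisms $\Phi_{(f',g'),(f,g)}\colon F(f',g')\circ F(f,g)\Rightarrow F(f'f,g'g)$ are the identity 2-morphism if $f'=\mathrm{id}$ or if $g=\mathrm{id}$. Unit coherence 2-isomorphisms $\mathrm{id}_{F(A,B)}\Rightarrow F(\mathrm{id}_A,\mathrm{id}_B)$ are not listed as part of the data, each of them being the identity. Semistrict monoidal 2-category (Gray monoid). It is a monoid $(\mathbf{M},1,\otimes,\{\Phi_{(f',g'),(f,g)}\})$ in the monoidal category of (strict) 2-categories and pseudofunctors under cartesian product, whose tensor product pseudofunctor $(\otimes,\Phi)\colon\mathbf{M}\times\mathbf{M}\to\mathbf{M}$ is cubical. Since $\Phi_{(\mathrm{id},g),(f,\mathrm{id})}$ is an identity, $\phi_{f,g}:=\Phi_{(f,\mathrm{id}_{B'}),(\mathrm{id}_A,g)}$ is a 2-isomorphism $(f\otimes\mathrm{id}_{B'})\circ(\mathrm{id}_A\otimes g)\Rightarrow(\mathrm{id}_{A'}\otimes g)\circ(f\otimes\mathrm{id}_B)$ for $f\colon A\to A'$, $g\colon B\to B'$. Symmetric monoidal bicategory (in the sense of Schommer-Pries and Stay). It has an underlying monoidal bicategory together with a braiding transformation $\beta=(\beta_{A,B},\beta_{f,g})\colon\otimes\Rightarrow\otimes\circ\mathrm{swap}$,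 with 1-morphisms $\beta_{A,B}\colon A\otimes B\to B\otimes A$ and 2-isomorphisms $\beta_{f,g}\colon(g\otimes f)\circ\beta_{A,B}\Rightarrow\beta_{A',B'}\circ(f\otimes g)$ for $f\colon A\to A'$, $g\colon B\to B'$. It also has invertible modifications $R_{A,B|C}$ (comparing $\beta_{A\otimes B,C}$ with $(\beta_{A,C}\otimes\mathrm{id}_B)\circ(\mathrm{id}_A\otimes\beta_{B,C})$), $S_{A|B,C}$ (comparing $\beta_{A,B\otimes C}$ with $(\mathrm{id}_B\otimes\beta_{A,C})\circ(\beta_{A,B}\otimes\mathrm{id}_C)$), and $\sigma_{A,B}\colon\mathrm{id}_{A\otimes B}\Rightarrow\beta_{B,A}\circ\beta_{A,B}$, satisfying the usual coherence axioms. Crans semistrict symmetric monoidal 2-category. It is a symmetric monoidal bicategory $\mathbf{M}$ such that the underlying monoidal bicategory is a Gray monoid, and for all objects $A,B$: (a) the 1-morphisms $\beta_{1,A}$ and $\beta_{A,1}$ are identities of $A$; (b) $R_{1,A|B}$, $R_{A,1|B}$, $S_{A|1,B}$ and $S_{A|B,1}$ are the identity 2-isomorphism of $\beta_{A,B}$; (c) $R_{A,B|1}$ and $S_{1|A,B}$ are the identity 2-isomorphisms of $\mathrm{id}_{A\otimes B}$. Quasistrict symmetric monoidal 2-category (Schommer-Pries). It is a Crans semistrict symmetric monoidal 2-category $\mathbf{M}$ such that: (QS.1) the modifications $R$, $S$ and $\sigma$ are identities; (QS.2) the component $\beta_{f,g}$ is the identity if either $f$ or $g$ is an identity morphism; (QS.3)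 $\Phi_{(f',g'),(f,g)}\colon(f'\otimes g')\circ(f\otimes g)\Rightarrow(f'\circ f)\otimes(g'\circ g)$ is an identity if $f'=\beta_{A,B}$ or $g=\beta_{A,B}$ for some pair of objects $A,B$. Stringent monoidal 2-category $(\mathbf{M},1,\otimes,\{\phi_{f,g}\})$. It consists of a 2-category $\mathbf{M}$ with the following data and axioms. (a) An object $1$, and for any two objects $A,B$ an object $A\otimes B$. The tensor product of objects is strictly associative and unital, and for each object $A$ it extends to strict 2-functors $L_A=A\otimes-$ and $R_A=-\otimes A$ from $\mathbf{M}$ to itself, with $L_AL_B=L_{A\otimes B}$, $R_BR_A=R_{A\otimes B}$ and $L_AR_B=R_BL_A$ (and, $1$ being a strict unit, $L_1=R_1=\mathrm{Id}$). Write $f\otimes\mathrm{id}_B:=R_B(f)$, $\mathrm{id}_B\otimes f:=L_B(f)$ for 1-morphisms and $\alpha\otimes B:=R_B(\alpha)$, $B\otimes\alpha:=L_B(\alpha)$ for 2-morphisms. (b) For all $f\colon A\to A'$, $g\colon B\to B'$, an interchangor 2-isomorphism $\phi_{f,g}\colon(f\otimes\mathrm{id}_{B'})\circ(\mathrm{id}_A\otimes g)\Rightarrow(\mathrm{id}_{A'}\otimes g)\circ(f\otimes\mathrm{id}_B)$. (c) (Nudging.) For all $f\colon A\to A'$, $g\colon B\to B'$: $(\mathrm{id}_{A'}\otimes g)\circ(f\otimes\mathrm{id}_B)=f\otimes g$. (The tensor product of two 1-morphisms is thus given by the functors $L,R$, and that of 2-morphisms accordingly.) (d) For $f\colon A\to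 A'$, $g\colon B\to B'$, $h\colon C\to C'$: $\phi_{\mathrm{id}_A\otimes g,h}=A\otimes\phi_{g,h}$, $\phi_{f\otimes\mathrm{id}_B,h}=\phi_{f,\mathrm{id}_B\otimes h}$, $\phi_{f,g\otimes\mathrm{id}_C}=\phi_{f,g}\otimes C$. (e) $\phi_{f,\mathrm{id}}=\mathrm{id}$ and $\phi_{\mathrm{id},g}=\mathrm{id}$ for all 1-morphisms $f,g$. (f) For $\alpha\colon f\Rightarrow f'$ with $f,f'\colon A\to A'$, and $g\colon B\to B'$: $\phi_{f',g}\circ((\alpha\otimes B')\ast\mathrm{id}_{\mathrm{id}_A\otimes g})=(\mathrm{id}_{\mathrm{id}_{A'}\otimes g}\ast(\alpha\otimes B))\circ\phi_{f,g}$. Similarly for $\gamma\colon g\Rightarrow g'$: $\phi_{f,g'}\circ(\mathrm{id}_{f\otimes\mathrm{id}_{B'}}\ast(A\otimes\gamma))=((A'\otimes\gamma)\ast\mathrm{id}_{f\otimes\mathrm{id}_B})\circ\phi_{f,g}$. (g) For $f\colon A\to A'$, $g\colon B\to B'$, $g'\colon B'\to B''$: $\phi_{f,g'g}=(\mathrm{id}_{\mathrm{id}_{A'}\otimes g'}\ast\phi_{f,g})\circ(\phi_{f,g'}\ast\mathrm{id}_{\mathrm{id}_A\otimes g})$. Correspondingly, for $f\colon A\to A'$, $f'\colon A'\to A''$, $g\colon B\to B'$: $\phi_{f'f,g}=(\phi_{f',g}\ast\mathrm{id}_{f\otimes\mathrm{id}_B})\circ(\mathrm{id}_{f'\otimes\mathrm{id}_{B'}}\ast\phi_{f,g})$.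 Stringent symmetric monoidal 2-category $(\mathbf{M},1,\otimes,\{\phi_{f,g}\},\{\beta_{A,B}\})$. It is a stringent monoidal 2-category equipped with, for every pair of objects $A,B$, a 1-morphism $\beta_{A,B}\colon A\otimes B\to B\otimes A$ such that the following hold on the nose: (i) $\beta_{B,A}\circ\beta_{A,B}=\mathrm{id}_{A\otimes B}$; (ii) $\beta_{A\otimes B,C}=(\beta_{A,C}\otimes\mathrm{id}_B)\circ(\mathrm{id}_A\otimes\beta_{B,C})$, and similarly $\beta_{A,B\otimes C}=(\mathrm{id}_B\otimes\beta_{A,C})\circ(\beta_{A,B}\otimes\mathrm{id}_C)$; (iii) for every 1-morphism $f\colon A\to A'$, $\beta_{A',B}\circ(f\otimes\mathrm{id}_B)=(\mathrm{id}_B\otimes f)\circ\beta_{A,B}$, and similarly for every $g\colon B\to B'$, $\beta_{A,B'}\circ(\mathrm{id}_A\otimes g)=(g\otimes\mathrm{id}_A)\circ\beta_{A,B}$; (iv) $\phi_{f,\beta_{B,C}}=\mathrm{id}$ for every 1-morphism $f\colon A\to A'$ and every pair of objects $B,C$, and similarly $\phi_{\beta_{A,B},g}=\mathrm{id}$ for every $g\colon C\to C'$ and every pair of objects $A,B$.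
   Formalization: In (2) and (3) stringent structures must also have β natural for 2-morphisms and satisfy (φ_{g,f}∗β_{A,B})∘(β_{A',B'}∗φ_{f,g})=id; otherwise (2) fails (one object, 1- and 2-morphisms Z, φ_{m,n}=mn, β=id). Part (1) shows both conditions hold in every quasistrict case. *)

(* Defs.v *)
Set Implicit Arguments.
Unset Strict Implicit.
Unset Printing Implicit Defensive.
Set Asymmetric Patterns.

Declare Scope cell_scope.
Declare Scope paste_scope.
Delimit Scope cell_scope with cell.
Delimit Scope paste_scope with paste.

Record twocat_data := TwoCatData {
  ob :> Type;
  hom : ob -> ob -> Type;
  hom2 : forall A B : ob, hom A B -> hom A B -> Type;
  id1 : forall A : ob, hom A A;
  comp : forall A B C : ob, hom B C -> hom A B -> hom A C;
  id2 : forall (A B : ob) (f : hom A B), hom2 f f;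
  vcomp : forall (A B : ob) (f g h : hom A B),
    hom2 g h -> hom2 f g -> hom2 f h;
  hcomp : forall (A B C : ob) (g g' : hom B C) (f f' : hom A B),
    hom2 g g' -> hom2 f f' -> hom2 (comp g f) (comp g' f')
}.

Arguments hom {t} A B.
Arguments hom2 {t A B} f g.
Arguments id1 {t} A.
Arguments comp {t A B C} g f.
Arguments id2 {t A B} f.
Arguments vcomp {t A B f g h} b a.
Arguments hcomp {t A B C g g' f f'} b a.

Notation "g \o f" := (comp g f) (at level 40, left associativity) : cell_scope.
Notation "b \v a" := (vcomp b a) (at level 45, left associativity) : cell_scope.
Notation "b \* a" := (hcomp b a) (at level 40, left associativity) : cell_scope.
Local Open Scope cell_scope.

(* 1- and 2-morphisms bundled with their boundaries.  Strict associativity of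
   composition and of the tensor product only holds up to propositional equality
   of boundaries, so equations between cells whose boundaries are not
   syntactically the same are stated as equalities of bundled cells. *)
Record cell1 (M : twocat_data) := Cell1 {
  c1dom : M; c1cod : M; c1mor : hom c1dom c1cod }.

Record cell2 (M : twocat_data) := Cell2 {
  c2dom : M; c2cod : M;
  c2src : hom c2dom c2cod; c2tgt : hom c2dom c2cod;
  c2mor : hom2 c2src c2tgt }.

Arguments Cell1 {M c1dom c1cod} c1mor.
Arguments Cell2 {M c2dom c2cod c2src c2tgt} c2mor.

Definition src {M} (c : cell2 M) : cell1 M := Cell1 (c2src c).
Definition tgt {M} (c : cell2 M) : cell1 M := Cell1 (c2tgt c).

(* This includes the equality of the source and the target of [c]. *)
Definition is_identity {M} (c : cell2 M) : Prop := c = Cell2 (id2 (c2src c)).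

Record is_twocat (M : twocat_data) : Prop := {
  comp_idl : forall (A B : M) (f : hom A B), id1 B \o f = f;
  comp_idr : forall (A B : M) (f : hom A B), f \o id1 A = f;
  comp_assoc : forall (A B C D : M) (h : hom C D) (g : hom B C) (f : hom A B),
    h \o (g \o f) = h \o g \o f;
  vcomp_idl : forall (A B : M) (f g : hom A B) (a : hom2 f g), id2 g \v a = a;
  vcomp_idr : forall (A B : M) (f g : hom A B) (a : hom2 f g), a \v id2 f = a;
  vcomp_assoc : forall (A B : M) (f g h k : hom A B)
    (c : hom2 h k) (b : hom2 g h) (a : hom2 f g), c \v (b \v a) = c \v b \v a;
  hcomp_id : forall (A B C : M) (g : hom B C) (f : hom A B),
    id2 g \* id2 f = id2 (g \o f);
  interchange : forall (A B C : M) (g g' g'' : hom B C) (f f' f'' : hom A B)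
    (b' : hom2 g' g'') (b : hom2 g g') (a' : hom2 f' f'') (a : hom2 f f'),
    (b' \v b) \* (a' \v a) = (b' \* a') \v (b \* a);
  hcomp_idl : forall (A B : M) (f g : hom A B) (a : hom2 f g),
    Cell2 (id2 (id1 B) \* a) = Cell2 a;
  hcomp_idr : forall (A B : M) (f g : hom A B) (a : hom2 f g),
    Cell2 (a \* id2 (id1 A)) = Cell2 a;
  hcomp_assoc : forall (A B C D : M) (h h' : hom C D) (g g' : hom B C)
    (f f' : hom A B) (c : hom2 h h') (b : hom2 g g') (a : hom2 f f'),
    Cell2 (c \* (b \* a)) = Cell2 (c \* b \* a)
}.

Record TwoCat := {
  twocat_of :> twocat_data;
  twocatP : is_twocat twocat_of
}.

Definition inverse2 {M : twocat_data} {A B : M} {f g : hom A B}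
    (a : hom2 f g) (b : hom2 g f) : Prop :=
  b \v a = id2 f /\ a \v b = id2 g.

Definition invertible {M : twocat_data} (c : cell2 M) : Prop :=
  exists b, inverse2 (c2mor c) b.

(* [is_comp1 g f k]: the bundled 1-morphisms g and f are composable, and k is
   their composite.  Similarly for the vertical and horizontal composites and
   for the inverse of bundled 2-morphisms. *)
Inductive is_comp1 (M : twocat_data) : cell1 M -> cell1 M -> cell1 M -> Prop :=
  IsComp1 (A B C : M) (g : hom B C) (f : hom A B) :
    is_comp1 (Cell1 g) (Cell1 f) (Cell1 (g \o f)).

Inductive is_vcomp (M : twocat_data) : cell2 M -> cell2 M -> cell2 M -> Prop :=
  IsVcomp (A B : M) (f g h : hom A B) (b : hom2 g h) (a : hom2 f g) :
    is_vcomp (Cell2 b) (Cell2 a) (Cell2 (b \v a)).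

Inductive is_hcomp (M : twocat_data) : cell2 M -> cell2 M -> cell2 M -> Prop :=
  IsHcomp (A B C : M) (g g' : hom B C) (f f' : hom A B)
      (b : hom2 g g') (a : hom2 f f') :
    is_hcomp (Cell2 b) (Cell2 a) (Cell2 (b \* a)).

Inductive is_inv (M : twocat_data) : cell2 M -> cell2 M -> Prop :=
  IsInv (A B : M) (f g : hom A B) (a : hom2 f g) (b : hom2 g f) :
    inverse2 a b -> is_inv (Cell2 a) (Cell2 b).

(* A cubical functor C x C' -> D, written out in terms of the components of
   objects, 1-morphisms and 2-morphisms of C x C'. *)
Record bifun_data (C C' D : twocat_data) := BifunData {
  F0 : C -> C' -> D;
  F1 : forall (A A' : C) (B B' : C'),
    hom A A' -> hom B B' -> hom (F0 A B) (F0 A' B');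
  F2 : forall (A A' : C) (B B' : C') (f f' : hom A A') (g g' : hom B B'),
    hom2 f f' -> hom2 g g' -> hom2 (F1 f g) (F1 f' g')
}.

Arguments F0 {C C' D} b A B.
Arguments F1 {C C' D} b {A A' B B'} f g.
Arguments F2 {C C' D} b {A A' B B' f f' g g'} a c.

Definition bifun_coherence (C C' D : twocat_data) (F : bifun_data C C' D) :=
  forall (A A' A'' : C) (B B' B'' : C')
    (f' : hom A' A'') (g' : hom B' B'') (f : hom A A') (g : hom B B'),
    hom2 (F1 F f' g' \o F1 F f g) (F1 F (f' \o f) (g' \o g)).

(* The unit coherence 2-morphisms of the pseudofunctors considered here are
   identities: [pf_id], [pf_unitl] and [pf_unitr] are the unit axioms. *)
Record is_pseudofunctor (C C' D : twocat_data) (F : bifun_data C C' D)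
    (Phi : bifun_coherence F) : Prop := {
  pf_id2 : forall (A A' : C) (B B' : C') (f : hom A A') (g : hom B B'),
    F2 F (id2 f) (id2 g) = id2 (F1 F f g);
  pf_vcomp : forall (A A' : C) (B B' : C')
    (f f' f'' : hom A A') (g g' g'' : hom B B')
    (a' : hom2 f' f'') (a : hom2 f f') (c' : hom2 g' g'') (c : hom2 g g'),
    F2 F (a' \v a) (c' \v c) = F2 F a' c' \v F2 F a c;
  pf_id : forall (A : C) (B : C'), F1 F (id1 A) (id1 B) = id1 (F0 F A B);
  pf_iso : forall (A A' A'' : C) (B B' B'' : C')
    (f' : hom A' A'') (g' : hom B' B'') (f : hom A A') (g : hom B B'),
    invertible (Cell2 (Phi _ _ _ _ _ _ f' g' f g));
  pf_nat : forall (A A' A'' : C) (B B' B'' : C')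
    (f' k' : hom A' A'') (g' l' : hom B' B'') (f k : hom A A') (g l : hom B B')
    (a' : hom2 f' k') (c' : hom2 g' l') (a : hom2 f k) (c : hom2 g l),
    Phi _ _ _ _ _ _ k' l' k l \v (F2 F a' c' \* F2 F a c)
    = F2 F (a' \* a) (c' \* c) \v Phi _ _ _ _ _ _ f' g' f g;
  pf_unitl : forall (A A' : C) (B B' : C') (f : hom A A') (g : hom B B'),
    is_identity (Cell2 (Phi _ _ _ _ _ _ (id1 A') (id1 B') f g));
  pf_unitr : forall (A A' : C) (B B' : C') (f : hom A A') (g : hom B B'),
    is_identity (Cell2 (Phi _ _ _ _ _ _ f g (id1 A) (id1 B)));
  pf_assoc : forall (A A' A'' A''' : C) (B B' B'' B''' : C')
    (f'' : hom A'' A''') (g'' : hom B'' B''') (f' : hom A' A'')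
    (g' : hom B' B'') (f : hom A A') (g : hom B B'),
    Cell2 (Phi _ _ _ _ _ _ (f'' \o f') (g'' \o g') f g
           \v (Phi _ _ _ _ _ _ f'' g'' f' g' \* id2 (F1 F f g)))
    = Cell2 (Phi _ _ _ _ _ _ f'' g'' (f' \o f) (g' \o g)
             \v (id2 (F1 F f'' g'') \* Phi _ _ _ _ _ _ f' g' f g))
}.

Record is_cubical (C C' D : twocat_data) (F : bifun_data C C' D)
    (Phi : bifun_coherence F) : Prop := {
  cubical_pf : is_pseudofunctor Phi;
  cubical_l : forall (A A' : C) (B B' B'' : C')
    (g' : hom B' B'') (f : hom A A') (g : hom B B'),
    is_identity (Cell2 (Phi _ _ _ _ _ _ (id1 A') g' f g));
  cubical_r : forall (A A' A'' : C) (B B' : C')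
    (f' : hom A' A'') (g' : hom B B') (f : hom A A'),
    is_identity (Cell2 (Phi _ _ _ _ _ _ f' g' f (id1 B)))
}.

Record tensor_data (M : twocat_data) := TensorData {
  one : M;
  bifun_of :> bifun_data M M M
}.

Arguments one {M} t.

(* The two sides of the last three axioms are the coherence 2-morphisms of the
   pseudofunctors (- @ -) @ - and - @ (- @ -), respectively 1 @ - and - @ 1. *)
Record is_gray_monoid (M : twocat_data) (T : tensor_data M)
    (Phi : bifun_coherence T) : Prop := {
  gray_cubical : is_cubical Phi;
  gray_assoc0 : forall A B C : M, F0 T (F0 T A B) C = F0 T A (F0 T B C);
  gray_unitl0 : forall A : M, F0 T (one T) A = A;
  gray_unitr0 : forall A : M, F0 T A (one T) = A;
  gray_assoc1 : forall (A A' B B' C C' : M)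
    (f : hom A A') (g : hom B B') (h : hom C C'),
    Cell1 (F1 T (F1 T f g) h) = Cell1 (F1 T f (F1 T g h));
  gray_unitl1 : forall (A A' : M) (f : hom A A'),
    Cell1 (F1 T (id1 (one T)) f) = Cell1 f;
  gray_unitr1 : forall (A A' : M) (f : hom A A'),
    Cell1 (F1 T f (id1 (one T))) = Cell1 f;
  gray_assoc2 : forall (A A' B B' C C' : M)
    (f f' : hom A A') (g g' : hom B B') (h h' : hom C C')
    (a : hom2 f f') (b : hom2 g g') (c : hom2 h h'),
    Cell2 (F2 T (F2 T a b) c) = Cell2 (F2 T a (F2 T b c));
  gray_unitl2 : forall (A A' : M) (f f' : hom A A') (a : hom2 f f'),
    Cell2 (F2 T (id2 (id1 (one T))) a) = Cell2 a;
  gray_unitr2 : forall (A A' : M) (f f' : hom A A') (a : hom2 f f'),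
    Cell2 (F2 T a (id2 (id1 (one T)))) = Cell2 a;
  gray_assocPhi : forall (A A' A'' B B' B'' C C' C'' : M)
    (f' : hom A' A'') (g' : hom B' B'') (h' : hom C' C'')
    (f : hom A A') (g : hom B B') (h : hom C C'),
    Cell2 (F2 T (Phi _ _ _ _ _ _ f' g' f g) (id2 (h' \o h))
           \v Phi _ _ _ _ _ _ (F1 T f' g') h' (F1 T f g) h)
    = Cell2 (F2 T (id2 (f' \o f)) (Phi _ _ _ _ _ _ g' h' g h)
             \v Phi _ _ _ _ _ _ f' (F1 T g' h') f (F1 T g h));
  gray_unitlPhi : forall (A A' A'' : M) (f' : hom A' A'') (f : hom A A'),
    Cell2 (Phi _ _ _ _ _ _ (id1 (one T)) f' (id1 (one T)) f)
    = Cell2 (id2 (f' \o f));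
  gray_unitrPhi : forall (A A' A'' : M) (f' : hom A' A'') (f : hom A A'),
    Cell2 (Phi _ _ _ _ _ _ f' (id1 (one T)) f (id1 (one T)))
    = Cell2 (id2 (f' \o f))
}.

Definition ctensor {M : twocat_data} (T : tensor_data M) (x y : cell2 M)
    : cell2 M :=
  Cell2 (F2 T (c2mor x) (c2mor y)).

(* Pasting expressions in bundled 2-morphisms.  An expression denotes the set of
   its values, which has at most one element and is empty if the boundaries of
   some composite do not match.  [x == y] says that both expressions are defined
   and have the same value. *)
Definition paste (M : twocat_data) := cell2 M -> Prop.

Definition pcell {M : twocat_data} (c : cell2 M) : paste M := fun z => z = c.
Definition pvcomp {M : twocat_data} (y x : paste M) : paste M :=
  fun z => exists b a, y b /\ x a /\ is_vcomp b a z.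
Definition phcomp {M : twocat_data} (y x : paste M) : paste M :=
  fun z => exists b a, y b /\ x a /\ is_hcomp b a z.
Definition pinv {M : twocat_data} (x : paste M) : paste M :=
  fun z => exists a, x a /\ is_inv a z.
Definition ptensor {M : twocat_data} (T : tensor_data M) (x y : paste M)
    : paste M :=
  fun z => exists a b, x a /\ y b /\ z = ctensor T a b.
Definition peq {M : twocat_data} (x y : paste M) : Prop :=
  exists z, x z /\ y z.

Bind Scope paste_scope with paste.
Arguments pvcomp {M} (y x)%_paste.
Arguments phcomp {M} (y x)%_paste.
Arguments pinv {M} x%_paste.
Arguments ptensor {M} T (x y)%_paste.
Arguments peq {M} (x y)%_paste.
Notation "[: a :]" := (pcell (Cell2 a%cell)) (at level 0, a at level 200)
  : paste_scope.
Notation "[1 f ]" := (pcell (Cell2 (id2 f%cell))) (at level 0, f at level 200)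
  : paste_scope.
Notation "[< c >]" := (pcell c%cell) (at level 0, c at level 200) : paste_scope.
Notation "y \v x" := (pvcomp y x) : paste_scope.
Notation "y \* x" := (phcomp y x) : paste_scope.
Notation "x == y" := (peq x y) (at level 70, no associativity) : paste_scope.

(* R and S are bundled because the source and the target of R_{A,B|C} are
   1-morphisms (A @ B) @ C -> C @ (A @ B) and A @ (B @ C) -> (C @ A) @ B. *)
Record symmon_data (M : twocat_data) := SymmonData {
  sm_tensor :> tensor_data M;
  Phi : bifun_coherence sm_tensor;
  beta : forall A B : M, hom (F0 sm_tensor A B) (F0 sm_tensor B A);
  beta2 : forall (A A' B B' : M) (f : hom A A') (g : hom B B'),
    hom2 (F1 sm_tensor g f \o beta A B) (beta A' B' \o F1 sm_tensor f g);
  modR : M -> M -> M -> cell2 M;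
  modS : M -> M -> M -> cell2 M;
  sigma : forall A B : M, hom2 (id1 (F0 sm_tensor A B)) (beta B A \o beta A B)
}.

Arguments Phi {M} s {A A' A'' B B' B''} f' g' f g.
Arguments beta {M} s A B.
Arguments beta2 {M} s {A A' B B'} f g.
Arguments modR {M} s A B C.
Arguments modS {M} s A B C.
Arguments sigma {M} s A B.

Section Symmetric.

Context {M : twocat_data} (D : symmon_data M).

Local Notation "A @ B" := (F0 D A B) (at level 38, left associativity).
Local Notation "f # g" := (F1 D f g) (at level 38, left associativity)
  : cell_scope.
Local Notation "a ## c" := (F2 D a c) (at level 38, left associativity)
  : cell_scope.
Local Notation "x # y" := (ptensor D x y) : paste_scope.
Local Notation b := (beta D).
Local Notation "1" := id1 : cell_scope.

Record is_braiding_transformation : Prop := {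
  beta2_iso : forall (A A' B B' : M) (f : hom A A') (g : hom B B'),
    invertible (Cell2 (beta2 D f g));
  beta2_nat : forall (A A' B B' : M) (f f' : hom A A') (g g' : hom B B')
    (a : hom2 f f') (c : hom2 g g'),
    beta2 D f' g' \v ((c ## a) \* id2 (b A B))
    = (id2 (b A' B') \* (a ## c)) \v beta2 D f g;
  beta2_id : forall A B : M, is_identity (Cell2 (beta2 D (1 A) (1 B)));
  beta2_comp : forall (A A' A'' B B' B'' : M)
    (f' : hom A' A'') (g' : hom B' B'') (f : hom A A') (g : hom B B'),
    ([: beta2 D (f' \o f) (g' \o g) :] \v ([: Phi D g' f' g f :] \* [1 b A B])
     == ([1 b A'' B''] \* [: Phi D f' g' f g :])
        \v ([: beta2 D f' g' :] \* [1 f # g])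
        \v ([1 g' # f'] \* [: beta2 D f g :]))%paste
}.

(* The 2-morphism components at 1-morphisms of the transformations
   beta_{A,B} @ C and A @ beta_{B,C}. *)
Definition beta2_tensorr (A A' B B' C C' : M)
    (f : hom A A') (g : hom B B') (h : hom C C') : paste M :=
  (pinv [: Phi D (b A' B') (1 C') (f # g) h :]
   \v ([: beta2 D f g :] # [1 h])
   \v [: Phi D (g # f) h (b A B) (1 C) :])%paste.

Definition beta2_tensorl (A A' B B' C C' : M)
    (f : hom A A') (g : hom B B') (h : hom C C') : paste M :=
  (pinv [: Phi D (1 A') (b B' C') f (g # h) :]
   \v ([1 f] # [: beta2 D g h :])
   \v [: Phi D f (h # g) (1 A) (b B C) :])%paste.

(* R, S and sigma are invertible modifications. *)
Record are_modifications : Prop := {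
  R_src : forall A B C : M, src (modR D A B C) = Cell1 (b (A @ B) C);
  R_tgt : forall A B C : M,
    is_comp1 (Cell1 (b A C # 1 B)) (Cell1 (1 A # b B C)) (tgt (modR D A B C));
  R_iso : forall A B C : M, invertible (modR D A B C);
  R_mod : forall (A A' B B' C C' : M)
    (f : hom A A') (g : hom B B') (h : hom C C'),
    (([< modR D A' B' C' >] \* [1 f # g # h]) \v [: beta2 D (f # g) h :]
     == ([1 b A' C' # 1 B'] \* beta2_tensorl f g h)
        \v (beta2_tensorr f h g \* [1 1 A # b B C])
        \v ([1 h # (f # g)] \* [< modR D A B C >]))%paste;
  S_src : forall A B C : M, src (modS D A B C) = Cell1 (b A (B @ C));
  S_tgt : forall A B C : M,
    is_comp1 (Cell1 (1 B # b A C)) (Cell1 (b A B # 1 C)) (tgt (modS D A B C));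
  S_iso : forall A B C : M, invertible (modS D A B C);
  S_mod : forall (A A' B B' C C' : M)
    (f : hom A A') (g : hom B B') (h : hom C C'),
    (([< modS D A' B' C' >] \* [1 f # (g # h)]) \v [: beta2 D f (g # h) :]
     == ([1 1 B' # b A' C'] \* beta2_tensorr f g h)
        \v (beta2_tensorl g f h \* [1 b A B # 1 C])
        \v ([1 g # h # f] \* [< modS D A B C >]))%paste;
  sigma_iso : forall A B : M, invertible (Cell2 (sigma D A B));
  sigma_mod : forall (A A' B B' : M) (f : hom A A') (g : hom B B'),
    ([: sigma D A' B' :] \* [1 f # g]
     == ([1 b B' A'] \* [: beta2 D f g :])
        \v ([: beta2 D g f :] \* [1 b A B])
        \v ([1 f # g] \* [: sigma D A B :]))%paste
}.

(* The four axioms of a braiding, for the shapes A,B,C|D, A|B,C,D, A,B|C,D and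
   for the two Yang-Baxter 2-isomorphisms from
   (b B C @ A)(B @ b A C)(b A B @ C) to (C @ b A B)(b A C @ B)(A @ b B C);
   the two axioms of a syllepsis; and the axiom of a symmetry. *)
Record is_symmetric_coherent : Prop := {
  coh_R : forall A B C E : M,
    ((([< modR D A B E >] # [1 1 C]) \* [1 1 (A @ B) # b C E])
       \v [< modR D (A @ B) C E >]
     == ([1 b A E # 1 (B @ C)] \* ([1 1 A] # [< modR D B C E >]))
       \v [< modR D A (B @ C) E >])%paste;
  coh_S : forall A B C E : M,
    (([1 1 (B @ C) # b A E] \* ([< modS D A B C >] # [1 1 E]))
       \v [< modS D A (B @ C) E >]
     == (([1 1 B] # [< modS D A C E >]) \* [1 b A B # 1 (C @ E)])
       \v [< modS D A B (C @ E) >])%paste;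
  coh_RS : forall A B C E : M,
    (([1 1 C # b A E # 1 B]
        \* [: Phi D (b A C) (1 (E @ B)) (1 (A @ C)) (b B E) :]
        \* [1 1 A # b B C # 1 E])
       \v (([< modS D A C E >] # [1 1 B]) \* ([1 1 A] # [< modS D B C E >]))
       \v [< modR D A B (C @ E) >]
     == (([1 1 C] # [< modR D A B E >]) \* ([< modR D A B C >] # [1 1 E]))
       \v [< modS D (A @ B) C E >])%paste;
  coh_YB : forall A B C : M,
    (([< modS D A C B >] \* [1 1 A # b B C])
       \v [: beta2 D (1 A) (b B C) :]
       \v pinv ([1 b B C # 1 A] \* [< modS D A B C >])
     == ([1 1 C # b A B] \* [< modR D A B C >])
       \v pinv [: beta2 D (b A B) (1 C) :]
       \v pinv ([< modR D B A C >] \* [1 b A B # 1 C]))%paste;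
  coh_sigmal : forall A B C : M,
    (([< modS D C A B >] \* [< modR D A B C >]) \v [: sigma D (A @ B) C :]
     == ([1 1 A # b C B] \* ([: sigma D A C :] # [1 1 B]) \* [1 1 A # b B C])
       \v ([1 1 A] # [: sigma D B C :]))%paste;
  coh_sigmar : forall A B C : M,
    (([< modR D B C A >] \* [< modS D A B C >]) \v [: sigma D A (B @ C) :]
     == ([1 b B A # 1 C] \* ([1 1 B] # [: sigma D A C :]) \* [1 b A B # 1 C])
       \v ([: sigma D A B :] # [1 1 C]))%paste;
  coh_sym : forall A B : M,
    ([1 b A B] \* [: sigma D A B :] == [: sigma D B A :] \* [1 b A B])%paste
}.

(* Symmetric monoidal bicategories whose underlying monoidal bicategory is a
   Gray monoid (so that all its other coherence data are identities).  That the
   braiding is an equivalence follows from the existence of sigma. *)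
Record is_symmetric_gray_monoid : Prop := {
  sgm_gray : is_gray_monoid (@Phi M D);
  sgm_beta : is_braiding_transformation;
  sgm_mod : are_modifications;
  sgm_coh : is_symmetric_coherent
}.

Record is_crans_semistrict : Prop := {
  crans_sgm : is_symmetric_gray_monoid;
  crans_beta_l : forall A : M, Cell1 (b (one D) A) = Cell1 (1 A);
  crans_beta_r : forall A : M, Cell1 (b A (one D)) = Cell1 (1 A);
  crans_R1 : forall A B : M, modR D (one D) A B = Cell2 (id2 (b A B));
  crans_R2 : forall A B : M, modR D A (one D) B = Cell2 (id2 (b A B));
  crans_S2 : forall A B : M, modS D A (one D) B = Cell2 (id2 (b A B));
  crans_S3 : forall A B : M, modS D A B (one D) = Cell2 (id2 (b A B));
  crans_R3 : forall A B : M, modR D A B (one D) = Cell2 (id2 (1 (A @ B)));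
  crans_S1 : forall A B : M, modS D (one D) A B = Cell2 (id2 (1 (A @ B)))
}.

Record is_quasistrict : Prop := {
  qs_crans : is_crans_semistrict;
  qs1_R : forall A B C : M, is_identity (modR D A B C);
  qs1_S : forall A B C : M, is_identity (modS D A B C);
  qs1_sigma : forall A B : M, is_identity (Cell2 (sigma D A B));
  qs2_l : forall (A B B' : M) (g : hom B B'),
    is_identity (Cell2 (beta2 D (1 A) g));
  qs2_r : forall (A A' B : M) (f : hom A A'),
    is_identity (Cell2 (beta2 D f (1 B)));
  qs3_l : forall (A B X Y Y' Y'' : M)
    (g' : hom Y' Y'') (f : hom X (A @ B)) (g : hom Y Y'),
    is_identity (Cell2 (Phi D (b A B) g' f g));
  qs3_r : forall (A B X X' X'' Y : M)
    (f' : hom X' X'') (g' : hom (B @ A) Y) (f : hom X X'),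
    is_identity (Cell2 (Phi D f' g' f (b A B)))
}.

End Symmetric.

(* As in R and S above, the interchangors are bundled and their boundaries are
   part of the axioms.  L_A and R_B are id_A # - and - # id_B. *)
Record stringent_data (M : twocat_data) := StringentData {
  st_tensor :> tensor_data M;
  phi : forall A A' B B' : M, hom A A' -> hom B B' -> cell2 M;
  st_beta : forall A B : M, hom (F0 st_tensor A B) (F0 st_tensor B A)
}.

Arguments phi {M} s {A A' B B'} f g.
Arguments st_beta {M} s A B.

Section Stringent.

Context {M : twocat_data} (D : stringent_data M).

Local Notation "A @ B" := (F0 D A B) (at level 38, left associativity).
Local Notation "f # g" := (F1 D f g) (at level 38, left associativity)
  : cell_scope.
Local Notation "a ## c" := (F2 D a c) (at level 38, left associativity)
  : cell_scope.
Local Notation b := (st_beta D).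
Local Notation "1" := id1 : cell_scope.
Local Notation L2 A a := (id2 (id1 A) ## a).
Local Notation R2 B a := (a ## id2 (id1 B)).

Record is_stringent_monoidal : Prop := {
  st_assoc0 : forall A B C : M, (A @ B) @ C = A @ (B @ C);
  st_unitl0 : forall A : M, one D @ A = A;
  st_unitr0 : forall A : M, A @ one D = A;

  st_L_id : forall A X : M, 1 A # 1 X = 1 (A @ X);
  st_L_comp : forall (A X Y Z : M) (g : hom Y Z) (f : hom X Y),
    1 A # (g \o f) = (1 A # g) \o (1 A # f);
  st_L_id2 : forall (A X Y : M) (f : hom X Y), L2 A (id2 f) = id2 (1 A # f);
  st_L_vcomp : forall (A X Y : M) (f g h : hom X Y)
    (c : hom2 g h) (a : hom2 f g), L2 A (c \v a) = L2 A c \v L2 A a;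
  st_L_hcomp : forall (A X Y Z : M) (g g' : hom Y Z) (f f' : hom X Y)
    (c : hom2 g g') (a : hom2 f f'),
    Cell2 (L2 A (c \* a)) = Cell2 (L2 A c \* L2 A a);

  st_R_id : forall A X : M, 1 X # 1 A = 1 (X @ A);
  st_R_comp : forall (A X Y Z : M) (g : hom Y Z) (f : hom X Y),
    (g \o f) # 1 A = (g # 1 A) \o (f # 1 A);
  st_R_id2 : forall (A X Y : M) (f : hom X Y), R2 A (id2 f) = id2 (f # 1 A);
  st_R_vcomp : forall (A X Y : M) (f g h : hom X Y)
    (c : hom2 g h) (a : hom2 f g), R2 A (c \v a) = R2 A c \v R2 A a;
  st_R_hcomp : forall (A X Y Z : M) (g g' : hom Y Z) (f f' : hom X Y)
    (c : hom2 g g') (a : hom2 f f'),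
    Cell2 (R2 A (c \* a)) = Cell2 (R2 A c \* R2 A a);

  st_LL1 : forall (A B X Y : M) (f : hom X Y),
    Cell1 (1 A # (1 B # f)) = Cell1 (1 (A @ B) # f);
  st_LL2 : forall (A B X Y : M) (f g : hom X Y) (a : hom2 f g),
    Cell2 (L2 A (L2 B a)) = Cell2 (L2 (A @ B) a);
  st_RR1 : forall (A B X Y : M) (f : hom X Y),
    Cell1 (f # 1 A # 1 B) = Cell1 (f # 1 (A @ B));
  st_RR2 : forall (A B X Y : M) (f g : hom X Y) (a : hom2 f g),
    Cell2 (R2 B (R2 A a)) = Cell2 (R2 (A @ B) a);
  st_LR1 : forall (A B X Y : M) (f : hom X Y),
    Cell1 (1 A # (f # 1 B)) = Cell1 (1 A # f # 1 B);
  st_LR2 : forall (A B X Y : M) (f g : hom X Y) (a : hom2 f g),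
    Cell2 (L2 A (R2 B a)) = Cell2 (R2 B (L2 A a));
  st_L1_1 : forall (X Y : M) (f : hom X Y), Cell1 (1 (one D) # f) = Cell1 f;
  st_L1_2 : forall (X Y : M) (f g : hom X Y) (a : hom2 f g),
    Cell2 (L2 (one D) a) = Cell2 a;
  st_R1_1 : forall (X Y : M) (f : hom X Y), Cell1 (f # 1 (one D)) = Cell1 f;
  st_R1_2 : forall (X Y : M) (f g : hom X Y) (a : hom2 f g),
    Cell2 (R2 (one D) a) = Cell2 a;

  st_phi_src : forall (A A' B B' : M) (f : hom A A') (g : hom B B'),
    src (phi D f g) = Cell1 ((f # 1 B') \o (1 A # g));
  st_phi_tgt : forall (A A' B B' : M) (f : hom A A') (g : hom B B'),
    tgt (phi D f g) = Cell1 ((1 A' # g) \o (f # 1 B));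
  st_phi_iso : forall (A A' B B' : M) (f : hom A A') (g : hom B B'),
    invertible (phi D f g);

  st_nudge1 : forall (A A' B B' : M) (f : hom A A') (g : hom B B'),
    (1 A' # g) \o (f # 1 B) = f # g;
  st_nudge2 : forall (A A' B B' : M) (f f' : hom A A') (g g' : hom B B')
    (a : hom2 f f') (c : hom2 g g'),
    Cell2 (L2 A' c \* R2 B a) = Cell2 (a ## c);

  st_phi_L : forall (A B B' C C' : M) (g : hom B B') (h : hom C C'),
    phi D (1 A # g) h = ctensor D (Cell2 (id2 (1 A))) (phi D g h);
  st_phi_LR : forall (A A' B C C' : M) (f : hom A A') (h : hom C C'),
    phi D (f # 1 B) h = phi D f (1 B # h);
  st_phi_R : forall (A A' B B' C : M) (f : hom A A') (g : hom B B'),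
    phi D f (g # 1 C) = ctensor D (phi D f g) (Cell2 (id2 (1 C)));

  st_phi_idr : forall (A A' B : M) (f : hom A A'), is_identity (phi D f (1 B));
  st_phi_idl : forall (A B B' : M) (g : hom B B'), is_identity (phi D (1 A) g);

  st_phi_natl : forall (A A' B B' : M) (f f' : hom A A') (g : hom B B')
    (a : hom2 f f'),
    ([< phi D f' g >] \v ([: R2 B' a :] \* [1 1 A # g])
     == ([1 1 A' # g] \* [: R2 B a :]) \v [< phi D f g >])%paste;
  st_phi_natr : forall (A A' B B' : M) (f : hom A A') (g g' : hom B B')
    (c : hom2 g g'),
    ([< phi D f g' >] \v ([1 f # 1 B'] \* [: L2 A c :])
     == ([: L2 A' c :] \* [1 f # 1 B]) \v [< phi D f g >])%paste;

  st_phi_compr : forall (A A' B B' B'' : M)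
    (f : hom A A') (g : hom B B') (g' : hom B' B''),
    ([< phi D f (g' \o g) >]
     == ([1 1 A' # g'] \* [< phi D f g >])
        \v ([< phi D f g' >] \* [1 1 A # g]))%paste;
  st_phi_compl : forall (A A' A'' B B' : M)
    (f : hom A A') (f' : hom A' A'') (g : hom B B'),
    ([< phi D (f' \o f) g >]
     == ([< phi D f' g >] \* [1 f # 1 B])
        \v ([1 f' # 1 B'] \* [< phi D f g >]))%paste
}.

Record is_stringent_symmetric : Prop := {
  st_monoidal : is_stringent_monoidal;
  st_sym : forall A B : M, b B A \o b A B = 1 (A @ B);
  st_hexl : forall A B C : M,
    is_comp1 (Cell1 (b A C # 1 B)) (Cell1 (1 A # b B C))
      (Cell1 (b (A @ B) C));
  st_hexr : forall A B C : M,
    is_comp1 (Cell1 (1 B # b A C)) (Cell1 (b A B # 1 C))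
      (Cell1 (b A (B @ C)));
  st_natl : forall (A A' B : M) (f : hom A A'),
    b A' B \o (f # 1 B) = (1 B # f) \o b A B;
  st_natr : forall (A B B' : M) (g : hom B B'),
    b A B' \o (1 A # g) = (g # 1 A) \o b A B;
  st_phi_betar : forall (A A' B C : M) (f : hom A A'),
    is_identity (phi D f (b B C));
  st_phi_betal : forall (A B C C' : M) (g : hom C C'),
    is_identity (phi D (b A B) g)
}.

(* Naturality of the braiding with respect to 2-morphisms and to the
   interchangors: phi_{g,f} and phi_{f,g} are mutually inverse up to
   conjugation by the braiding.  These conditions do not follow from
   [is_stringent_symmetric], and they hold in every quasistrict symmetric
   monoidal 2-category.  With a single object, where beta is the identity, a
   stringent symmetric monoidal 2-category is a strict braided monoidal
   category with braiding phi, and [st_beta_phi] says that phi is a symmetry. *)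
Record is_braiding_natural : Prop := {
  st_natl2 : forall (A A' B : M) (f f' : hom A A') (a : hom2 f f'),
    Cell2 (id2 (b A' B) \* R2 B a) = Cell2 (L2 B a \* id2 (b A B));
  st_natr2 : forall (A B B' : M) (g g' : hom B B') (c : hom2 g g'),
    Cell2 (id2 (b A B') \* L2 A c) = Cell2 (R2 A c \* id2 (b A B));
  st_beta_phi : forall (A A' B B' : M) (f : hom A A') (g : hom B B'),
    (([< phi D g f >] \* [1 b A B]) \v ([1 b A' B'] \* [< phi D f g >])
     == [1 b A' B'] \* [1 f # 1 B'] \* [1 1 A # g])%paste
}.

End Stringent.

Definition restrict (M : twocat_data) (Q : symmon_data M) : stringent_data M :=
  {| st_tensor := sm_tensor Q;
     phi := fun A A' B B' f g => Cell2 (Phi Q f (id1 B') (id1 A) g);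
     st_beta := beta Q |}.

(* Main.v *)
From Stdlib Require Import ssreflect FunctionalExtensionality PropExtensionality.
From Stdlib Require Import ProofIrrelevance Eqdep Classical.
Require Import Defs.

(** The tensor product of 1-morphisms being nudged, f # g = (1 # g) o (f # 1),
    the pseudofunctor axiom applied to (1, g'), (f', 1), (1, g), (f, 1) shows that
    Phi_{(f',g'),(f,g)} is the whiskering of phi_{f',g} by 1 # g' and f # 1.
    Likewise the composition axiom of the braiding, applied to (f, 1), (1, g),
    gives beta_{f,g} = beta * phi_{f,g}, and applied to (1, g), (f, 1) it says
    that this 2-morphism is inverse to phi_{g,f} * beta.  So the quasistrict data
    are determined by phi and beta, and the same two formulas define them from
    stringent data.

    Boundaries match only up to propositional equality, so the computations take
    place among pasting expressions.  These form a strict (partial) algebra: the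
    associativity laws of the three operations are equalities of predicates on
    cells, without any side condition on boundaries. *)

Set Implicit Arguments.
Unset Strict Implicit.
Unset Printing Implicit Defensive.

(** * The algebra of pasting expressions *)

Local Open Scope cell_scope.
Local Open Scope paste_scope.

Local Arguments Cell1 {M c1dom c1cod} c1mor%_cell.
Local Arguments Cell2 {M c2dom c2cod c2src c2tgt} c2mor%_cell.

Local Ltac injcell H :=
  inversion H; subst; repeat match goal with
  | E : existT _ _ _ = existT _ _ _ |- _ => apply inj_pair2 in E; subst end.

Section Paste.

Context {M : TwoCat}.
Implicit Types (A B C : M) (p q r x y z : paste M) (c d : cell2 M).

(** * Bundled cells and inversion of their composites *)

Lemma Cell1_inj A B (f g : hom A B) : Cell1 f = Cell1 g -> f = g.
Proof. by move=> H; injcell H. Qed.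

Lemma Cell2_inj A B (f g : hom A B) (a b : hom2 f g) : Cell2 a = Cell2 b -> a = b.
Proof. by move=> H; injcell H. Qed.

Lemma Cell2_id A B (f : hom A B) A' B' (f' : hom A' B') :
  Cell1 f = Cell1 f' -> Cell2 (id2 f) = Cell2 (id2 f').
Proof. by move=> H; injcell H. Qed.

Lemma Cell1_of_id A B (f : hom A B) A' B' (f' : hom A' B') :
  Cell2 (id2 f) = Cell2 (id2 f') -> Cell1 f = Cell1 f'.
Proof. by move=> H; apply: (f_equal src H). Qed.

(** A bundled cell whose boundaries agree propositionally with [f] and [g] can be transported to the
    type [hom2 f g]. Being a sigma type in [Type], the result can be projected to define data, which
    is how the coherence cells below are built. *)
Lemma cell2_with_boundary c A B (f g : hom A B) :
  src c = Cell1 f -> tgt c = Cell1 g -> {a : hom2 f g | Cell2 a = c}.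
Proof.
case: c => A' B' f' g' a /= H1 H2.
have EA : A' = A by apply: (f_equal (@c1dom M) H1).
have EB : B' = B by apply: (f_equal (@c1cod M) H1).
subst A' B'.
have Ef : f' = f := Cell1_inj H1; have Eg : g' = g := Cell1_inj H2; subst f' g'.
by exists a.
Qed.

Lemma pasteP p q : (forall c, p c <-> q c) -> p = q.
Proof.
move=> H; apply: functional_extensionality => c.
by apply: propositional_extensionality.
Qed.

Lemma pcell_inj c d : pcell c = pcell d -> c = d.
Proof. by move=> H; have : pcell d c by rewrite -H. Qed.

Lemma hcomp_invl B C (g g' : hom B C) (b : hom2 g g') c d :
  is_hcomp (Cell2 b) c d ->
  exists A (f f' : hom A B) (a : hom2 f f'), c = Cell2 a /\ d = Cell2 (b \* a).
Proof.
move E : (Cell2 b) => e H; case: H E => A' B' C' k k' f f' b' a E.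
by injcell E; exists A', f, f', a.
Qed.

Lemma hcomp_invr A B (f f' : hom A B) (a : hom2 f f') c d :
  is_hcomp c (Cell2 a) d ->
  exists C (g g' : hom B C) (b : hom2 g g'), c = Cell2 b /\ d = Cell2 (b \* a).
Proof.
move E : (Cell2 a) => e H; case: H E => A' B' C' k k' h h' b' a' E.
by injcell E; exists C', k, k', b'.
Qed.

Lemma hcomp_inv A B C (g g' : hom B C) (b : hom2 g g') (f f' : hom A B)
  (a : hom2 f f') d : is_hcomp (Cell2 b) (Cell2 a) d -> d = Cell2 (b \* a).
Proof.
by move/hcomp_invl => [A' [h [h' [a' [E ->]]]]]; injcell E.
Qed.

Lemma vcomp_invl A B (g h : hom A B) (b : hom2 g h) c d :
  is_vcomp (Cell2 b) c d ->
  exists f (a : hom2 f g), c = Cell2 a /\ d = Cell2 (b \v a).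
Proof.
move E : (Cell2 b) => e H; case: H E => A' B' f' g' h' b' a E.
by injcell E; exists f', a.
Qed.

Lemma vcomp_invr A B (f g : hom A B) (a : hom2 f g) c d :
  is_vcomp c (Cell2 a) d ->
  exists h (b : hom2 g h), c = Cell2 b /\ d = Cell2 (b \v a).
Proof.
move E : (Cell2 a) => e H; case: H E => A' B' f' g' h' b' a' E.
by injcell E; exists h', b'.
Qed.

Lemma vcomp_inv A B (f g h : hom A B) (b : hom2 g h) (a : hom2 f g) d :
  is_vcomp (Cell2 b) (Cell2 a) d -> d = Cell2 (b \v a).
Proof. by move/vcomp_invl => [f' [a' [E ->]]]; injcell E. Qed.

Lemma inv_inv A B (f g : hom A B) (a : hom2 f g) d :
  is_inv (Cell2 a) d -> exists b, d = Cell2 b /\ inverse2 a b.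
Proof.
move E : (Cell2 a) => e H; case: H E => A' B' f' g' a' b' H E.
by injcell E; exists b'.
Qed.

Lemma inverse2_uniq A B (f g : hom A B) (a : hom2 f g) b b' :
  inverse2 a b -> inverse2 a b' -> b = b'.
Proof.
move=> [H1 H2] [H3 H4].
rewrite -(vcomp_idl (twocatP M) b) -H3 -(vcomp_assoc (twocatP M)) H2.
by rewrite (vcomp_idr (twocatP M)).
Qed.

(** * Strict laws of composition for expressions *)

Lemma phcompE A B C (g g' : hom B C) (b : hom2 g g') (f f' : hom A B)
  (a : hom2 f f') : [: b \* a :] = [: b :] \* [: a :].
Proof.
apply: pasteP => c; split=> [->|[_ [_ [-> [-> /hcomp_inv ->]]]]] //.
by exists (Cell2 b), (Cell2 a); do 2 split=> //.
Qed.

Lemma pvcompE A B (f g h : hom A B) (b : hom2 g h) (a : hom2 f g) :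
  [: b \v a :] = [: b :] \v [: a :].
Proof.
apply: pasteP => c; split=> [->|[_ [_ [-> [-> /vcomp_inv ->]]]]] //.
by exists (Cell2 b), (Cell2 a); do 2 split=> //.
Qed.

Lemma pcompE A B C (g : hom B C) (f : hom A B) : [1 g \o f] = [1 g] \* [1 f].
Proof. by rewrite -(hcomp_id (twocatP M)) phcompE. Qed.

Lemma phcompA x y z : z \* y \* x = z \* (y \* x).
Proof.
apply: pasteP => w; split.
- move=> [? [a [[c [b [zc [yb H]]]] [xa H2]]]].
  case: H zc yb H2 => A B C h h' g g' {}c {}b zc yb /hcomp_invl.
  move=> [A' [f [f' [a' [Ea ->]]]]]; subst a.
  exists (Cell2 c), (Cell2 (b \* a')); split=> //; split; last first.
    by rewrite -(hcomp_assoc (twocatP M)).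
  by exists (Cell2 b), (Cell2 a').
- move=> [c [? [zc [[b [a [yb [xa H]]]] H2]]]].
  case: H yb xa H2 => A B C g g' f f' {}b {}a yb xa /hcomp_invr.
  move=> [D [h [h' [c' [Ec ->]]]]]; subst c.
  exists (Cell2 (c' \* b)), (Cell2 a); split; last first.
    by split=> //; rewrite (hcomp_assoc (twocatP M)).
  by exists (Cell2 c'), (Cell2 b).
Qed.

Lemma pvcompA x y z : z \v y \v x = z \v (y \v x).
Proof.
apply: pasteP => w; split.
- move=> [? [a [[c [b [zc [yb H]]]] [xa H2]]]].
  case: H zc yb H2 => A B g h k {}c {}b zc yb /vcomp_invl.
  move=> [f [a' [Ea ->]]]; subst a.
  exists (Cell2 c), (Cell2 (b \v a')); split=> //; split.
    by exists (Cell2 b), (Cell2 a').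
  by rewrite -(vcomp_assoc (twocatP M)).
- move=> [c [? [zc [[b [a [yb [xa H]]]] H2]]]].
  case: H yb xa H2 => A B f g h {}b {}a yb xa /vcomp_invr.
  move=> [k [c' [Ec ->]]]; subst c.
  exists (Cell2 (c' \v b)), (Cell2 a); split.
    by exists (Cell2 c'), (Cell2 b).
  by split=> //; rewrite (vcomp_assoc (twocatP M)).
Qed.

Lemma phcomp1l A B (f g : hom A B) (a : hom2 f g) : [1 id1 B] \* [: a :] = [: a :].
Proof. by rewrite -phcompE (hcomp_idl (twocatP M)). Qed.

Lemma phcomp1r A B (f g : hom A B) (a : hom2 f g) : [: a :] \* [1 id1 A] = [: a :].
Proof. by rewrite -phcompE (hcomp_idr (twocatP M)). Qed.

Lemma pvcomp1l A B (f g : hom A B) (a : hom2 f g) : [1 g] \v [: a :] = [: a :].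
Proof. by rewrite -pvcompE (vcomp_idl (twocatP M)). Qed.

Lemma pvcomp1r A B (f g : hom A B) (a : hom2 f g) : [: a :] \v [1 f] = [: a :].
Proof. by rewrite -pvcompE (vcomp_idr (twocatP M)). Qed.

(** * Undefined expressions, unique values and identities *)

Definition pempty : paste M := fun _ => False.

Lemma phcomp0 x : pempty \* x = pempty.
Proof. by apply: pasteP => c; split=> // -[? [? []]]. Qed.
Lemma phcompx0 x : x \* pempty = pempty.
Proof. by apply: pasteP => c; split=> // -[? [? [_ []]]]. Qed.
Lemma pvcomp0 x : pempty \v x = pempty.
Proof. by apply: pasteP => c; split=> // -[? [? []]]. Qed.
Lemma pvcompx0 x : x \v pempty = pempty.
Proof. by apply: pasteP => c; split=> // -[? [? [_ []]]]. Qed.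

Lemma phcomp_mismatch A B B' C (g g' : hom B' C) (b : hom2 g g') (f f' : hom A B)
  (a : hom2 f f') : B <> B' -> [: b :] \* [: a :] = pempty.
Proof.
move=> N; apply: pasteP => c; split=> // -[_ [_ [-> [-> /hcomp_invl]]]].
by move=> [A' [k [k' [a' [/(f_equal (@c2cod M))]]]]].
Qed.

(** An expression is an arbitrary predicate, so uniqueness of its value has to be carried along; it
    holds for everything built from cells by composites and tensor products. *)
Definition subsingleton p := forall c d, p c -> p d -> c = d.
(** This is the expression form of a 1-morphism. Undefined expressions are included, so that the
    class is closed under [\*] even when boundaries do not match. *)
Definition is_one p := subsingleton p /\ forall c, p c -> is_identity c.

Lemma subsingletonP p : subsingleton p -> p = pempty \/ exists c, p = pcell c.
Proof.
move=> Sp; case: (classic (exists c, p c)) => [[c pc]|N]; [right|left].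
  by exists c; apply: pasteP => d; split=> [pd| ->] //; apply: Sp.
by apply: pasteP => c; split=> // pc; apply: N; exists c.
Qed.

Lemma is_oneP p : is_one p -> p = pempty \/ exists A B (f : hom A B), p = [1 f].
Proof.
move=> [/subsingletonP [->|[c ->]] H]; [by left|right].
by exists (c2dom c), (c2cod c), (c2src c); rewrite (H c).
Qed.

Lemma subsingleton_cell c : subsingleton (pcell c).
Proof. by move=> ? ? -> ->. Qed.

Lemma subsingleton_hcomp y x :
  subsingleton y -> subsingleton x -> subsingleton (y \* x).
Proof.
move=> Sy Sx c d [b [a [yb [xa H]]]] [b' [a' [yb' [xa' H']]]].
move: H'; rewrite (Sy b' b) // (Sx a' a) //.
by case: H => A B C g g' f f' ? ? /hcomp_inv ->.
Qed.

Lemma subsingleton_vcomp y x :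
  subsingleton y -> subsingleton x -> subsingleton (y \v x).
Proof.
move=> Sy Sx c d [b [a [yb [xa H]]]] [b' [a' [yb' [xa' H']]]].
move: H'; rewrite (Sy b' b) // (Sx a' a) //.
by case: H => A B f g h ? ? /vcomp_inv ->.
Qed.

Lemma subsingleton_tensor (T : tensor_data M) y x :
  subsingleton y -> subsingleton x -> subsingleton (ptensor T y x).
Proof.
move=> Sy Sx c d [b [a [yb [xa ->]]]] [b' [a' [yb' [xa' ->]]]].
by rewrite (Sy b' b) // (Sx a' a).
Qed.

Lemma is_one_sub p : is_one p -> subsingleton p.
Proof. by case. Qed.

Lemma is_one_id A B (f : hom A B) : is_one [1 f].
Proof. by split=> [|c ->] //; apply: subsingleton_cell. Qed.

Lemma is_one_hcomp y x : is_one y -> is_one x -> is_one (y \* x).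
Proof.
move=> Oy Ox; split; first by apply: subsingleton_hcomp; apply: is_one_sub.
case: (is_oneP Oy) => [->|[A [B [f ->]]]]; first by rewrite phcomp0.
case: (is_oneP Ox) => [->|[A' [B' [f' ->]]]]; first by rewrite phcompx0.
case: (classic (B' = A)) => [E|N]; last by rewrite phcomp_mismatch.
by subst; rewrite -pcompE => c ->.
Qed.

(** * Boundaries of expressions and the exchange law *)

Definition psrc p : paste M := fun d => exists2 c, p c & d = Cell2 (id2 (c2src c)).
Definition ptgt p : paste M := fun d => exists2 c, p c & d = Cell2 (id2 (c2tgt c)).

Lemma psrc_cell A B (f g : hom A B) (a : hom2 f g) : psrc [: a :] = [1 f].
Proof. by apply: pasteP => c; split=> [[_ -> ->]| ->] //; exists (Cell2 a). Qed.
Lemma ptgt_cell A B (f g : hom A B) (a : hom2 f g) : ptgt [: a :] = [1 g].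
Proof. by apply: pasteP => c; split=> [[_ -> ->]| ->] //; exists (Cell2 a). Qed.

Lemma psrc0 : psrc pempty = pempty.
Proof. by apply: pasteP => c; split=> // -[? []]. Qed.
Lemma ptgt0 : ptgt pempty = pempty.
Proof. by apply: pasteP => c; split=> // -[? []]. Qed.

Lemma psrc_one p : is_one p -> psrc p = p.
Proof.
by move/is_oneP => [->|[A [B [f ->]]]]; [rewrite psrc0|rewrite psrc_cell].
Qed.
Lemma ptgt_one p : is_one p -> ptgt p = p.
Proof.
by move/is_oneP => [->|[A [B [f ->]]]]; [rewrite ptgt0|rewrite ptgt_cell].
Qed.

Lemma psrc_hcomp y x : subsingleton y -> subsingleton x ->
  psrc (y \* x) = psrc y \* psrc x.
Proof.
move=> /subsingletonP [->|[[B' C g g' b] ->]].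
  by rewrite !(phcomp0, psrc0).
move=> /subsingletonP [->|[[A B f f' a] ->]].
  by rewrite !(phcompx0, psrc0).
rewrite !psrc_cell; case: (classic (B = B')) => [E|N].
  by subst; rewrite -phcompE -pcompE psrc_cell.
by rewrite !phcomp_mismatch // psrc0.
Qed.

Lemma ptgt_hcomp y x : subsingleton y -> subsingleton x ->
  ptgt (y \* x) = ptgt y \* ptgt x.
Proof.
move=> /subsingletonP [->|[[B' C g g' b] ->]].
  by rewrite !(phcomp0, ptgt0).
move=> /subsingletonP [->|[[A B f f' a] ->]].
  by rewrite !(phcompx0, ptgt0).
rewrite !ptgt_cell; case: (classic (B = B')) => [E|N].
  by subst; rewrite -phcompE -pcompE ptgt_cell.
by rewrite !phcomp_mismatch // ptgt0.
Qed.

(** By interchange both sides equal [y \* x]; if the boundaries do not match, both are undefined. *)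
Lemma exchange y x : subsingleton y -> subsingleton x ->
  (ptgt y \* x) \v (y \* psrc x) = (y \* ptgt x) \v (psrc y \* x).
Proof.
move=> /subsingletonP [->|[[B' C g g' b] ->]].
  by rewrite !(phcomp0, ptgt0, psrc0, pvcomp0).
move=> /subsingletonP [->|[[A B f f' a] ->]].
  by rewrite !(phcompx0, ptgt0, psrc0, pvcomp0).
rewrite !ptgt_cell !psrc_cell; case: (classic (B = B')) => [E|N].
  subst; rewrite -!phcompE -!pvcompE -!(interchange (twocatP M)).
  by rewrite !(vcomp_idl (twocatP M)) !(vcomp_idr (twocatP M)).
by rewrite !phcomp_mismatch // !pvcomp0.
Qed.

(** This is [exchange] for [k \* y] and [x \* m], since identity expressions are their own source
    and target. It settles the order of two interchangors acting on disjoint parts of a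
    composite. *)
Lemma whiskered_exchange k m y x : is_one k -> is_one m ->
  subsingleton y -> subsingleton x ->
  (k \* (ptgt y \* (x \* m))) \v (k \* (y \* (psrc x \* m)))
  = (k \* (y \* (ptgt x \* m))) \v (k \* (psrc y \* (x \* m))).
Proof.
move=> Ok Om Sy Sx; have Sk := is_one_sub Ok; have Sm := is_one_sub Om.
have := exchange (subsingleton_hcomp Sk Sy) (subsingleton_hcomp Sx Sm).
rewrite !psrc_hcomp // !ptgt_hcomp // !phcompA.
by rewrite !(psrc_one Ok, ptgt_one Ok, psrc_one Om, ptgt_one Om).
Qed.

(** * Whiskering of vertical composites, and equality of expressions *)

Lemma pvcomp_cell c y x : subsingleton y -> subsingleton x -> pcell c = y \v x ->
  exists A B (f g h : hom A B) (b : hom2 g h) (a : hom2 f g),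
    y = [: b :] /\ x = [: a :] /\ c = Cell2 (b \v a).
Proof.
move=> Sy Sx E; have [b [a [yb [xa H]]]] : (y \v x) c by rewrite -E.
case: H yb xa => A B f g h {}b {}a yb xa; exists A, B, f, g, h, b, a.
split; first by apply: pasteP => d; split=> [?| ->] //; apply: Sy.
by split=> //; apply: pasteP => d; split=> [?| ->] //; apply: Sx.
Qed.

(** The cell [c] witnesses that [y \v x] is defined. Without a witness the law can fail: whiskering
    may identify distinct 1-morphisms, and thus make the right-hand side defined while the left-hand
    side is empty. *)
Lemma whiskerl c k y x : subsingleton y -> subsingleton x -> is_one k ->
  pcell c = y \v x -> k \* pcell c = (k \* y) \v (k \* x).
Proof.
move=> Sy Sx Ok /(pvcomp_cell Sy Sx) [A [B [f [g [h [b [a [-> [-> ->]]]]]]]]].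
case: (is_oneP Ok) => [->|[B' [C [k0 ->]]]]; first by rewrite !phcomp0 pvcomp0.
case: (classic (B = B')) => [E|N].
  subst; rewrite -!phcompE -!pvcompE -!(interchange (twocatP M)).
  by rewrite (vcomp_idl (twocatP M)).
by rewrite !phcomp_mismatch // !pvcomp0.
Qed.

Lemma whiskerr c k y x : subsingleton y -> subsingleton x -> is_one k ->
  pcell c = y \v x -> pcell c \* k = (y \* k) \v (x \* k).
Proof.
move=> Sy Sx Ok /(pvcomp_cell Sy Sx) [A [B [f [g [h [b [a [-> [-> ->]]]]]]]]].
case: (is_oneP Ok) => [->|[B' [C [k0 ->]]]]; first by rewrite !phcompx0 pvcomp0.
case: (classic (C = A)) => [E|N].
  subst; rewrite -!phcompE -!pvcompE -!(interchange (twocatP M)).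
  by rewrite (vcomp_idl (twocatP M)).
by rewrite !phcomp_mismatch // !pvcomp0.
Qed.

Lemma whisker c k m y x : subsingleton y -> subsingleton x -> is_one k -> is_one m ->
  pcell c = y \v x ->
  k \* (pcell c \* m) = (k \* (y \* m)) \v (k \* (x \* m)).
Proof.
move=> Sy Sx Ok Om E; have := whiskerr Sy Sx Om E.
have Sm := is_one_sub Om.
case: (subsingletonP (subsingleton_hcomp (@subsingleton_cell c) Sm))
  => [-> E0|[d -> Ed]].
  (* Here [pcell c \* m] is undefined. Either [k] or [m] is empty, or the boundaries of [c] and [m]
     do not match; matching ones would give the composite a value. *)
  rewrite phcompx0; case: (is_oneP Ok) => [->|[B [C [k0 Ek]]]].
    by rewrite !phcomp0 pvcomp0.
  move: E0; case: (is_oneP Om) => [->|[A0 [A [m0 Em]]]].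
    by rewrite !phcompx0 pvcompx0.
  subst; have [A' [B' [f [g [h [b [a [-> [-> _]]]]]]]]] := pvcomp_cell Sy Sx E.
  case: (classic (A = A')) => [EA|N]; last first.
    by rewrite !phcomp_mismatch // !phcompx0 pvcompx0.
  subst; rewrite -!phcompE -pvcompE => E0.
  by have : pempty (Cell2 (b \* id2 m0 \v a \* id2 m0)%cell) by rewrite E0.
by apply: whiskerl => //; apply: subsingleton_hcomp.
Qed.

Lemma vcomp_one k : is_one k -> k \v k = k.
Proof.
case/is_oneP => [->|[A [B [f ->]]]]; first by rewrite pvcomp0.
by rewrite pvcomp1l.
Qed.

Lemma pvcomp_src x : subsingleton x -> x \v psrc x = x.
Proof.
case/subsingletonP => [->|[[A B f g a] ->]]; first by rewrite pvcomp0.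
by rewrite psrc_cell pvcomp1r.
Qed.

Lemma pvcomp_tgt x : subsingleton x -> ptgt x \v x = x.
Proof.
case/subsingletonP => [->|[[A B f g a] ->]]; first by rewrite pvcompx0.
by rewrite ptgt_cell pvcomp1l.
Qed.

Lemma pinv_one k : is_one k -> pinv k = k.
Proof.
case/is_oneP => [->|[A [B [f ->]]]]; first by apply: pasteP => c; split=> // -[? []].
have V : inverse2 (id2 f) (id2 f) by split; rewrite (vcomp_idl (twocatP M)).
apply: pasteP => c; split=> [[_ [-> /inv_inv [b [-> Vb]]]]| ->].
  by rewrite (inverse2_uniq Vb V).
by exists (Cell2 (id2 f)).
Qed.

Lemma is_comp1E (c1 c2 c3 : cell1 M) : is_comp1 c1 c2 c3 ->
  [1 c1mor c3] = [1 c1mor c1] \* [1 c1mor c2] :> paste M.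
Proof. by case=> A B C g f; rewrite pcompE. Qed.

(** Equality with the identity of any 1-morphism suffices, because equality of bundled cells forces
    the boundaries to agree. *)
Lemma is_identityE A B (f g : hom A B) (a : hom2 f g) A' B' (h : hom A' B') :
  [: a :] = [1 h] -> is_identity (Cell2 a).
Proof.
move=> /pcell_inj E; rewrite /is_identity /= E; apply: Cell2_id.
by rewrite -[Cell1 f]/(src (Cell2 a)) E.
Qed.

Lemma identityE A B (f g : hom A B) (a : hom2 f g) :
  is_identity (Cell2 a) -> [: a :] = [1 f] /\ f = g.
Proof.
move=> /= E; split; first by rewrite E.
by have /= := f_equal tgt E; rewrite /tgt /= => /Cell1_inj.
Qed.

Lemma identity_tgt A B (f g : hom A B) (a : hom2 f g) :
  is_identity (Cell2 a) -> [: a :] = [1 g].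
Proof. by move=> /identityE [-> ->]. Qed.

Lemma peq_refl c p q : p = pcell c -> q = pcell c -> p == q.
Proof. by move=> -> ->; exists c. Qed.

Lemma peqE p q : subsingleton p -> subsingleton q -> p == q -> p = q.
Proof.
move=> Sp Sq [c [pc qc]]; apply: pasteP => d.
by split=> [pd|qd]; [rewrite -(Sp c d)|rewrite -(Sq c d)].
Qed.

Lemma phcomp_cell c y x : subsingleton y -> subsingleton x -> pcell c = y \* x ->
  exists A B C (g g' : hom B C) (f f' : hom A B) (b : hom2 g g') (a : hom2 f f'),
    y = [: b :] /\ x = [: a :] /\ c = Cell2 (b \* a).
Proof.
move=> Sy Sx E; have [b [a [yb [xa H]]]] : (y \* x) c by rewrite -E.
case: H yb xa => A B C g g' f f' {}b {}a yb xa; exists A, B, C, g, g', f, f', b, a.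
split; first by apply: pasteP => d; split=> [?| ->] //; apply: Sy.
by split=> //; apply: pasteP => d; split=> [?| ->] //; apply: Sx.
Qed.

(** * Tensor products of expressions *)

Context (T : tensor_data M).

Local Notation "x # y" := (ptensor T x y) (at level 38, left associativity)
  : paste_scope.

Lemma ptensorE A A' B B' (f f' : hom A A') (g g' : hom B B')
  (a : hom2 f f') (b : hom2 g g') : [: F2 T a b :] = [: a :] # [: b :].
Proof.
apply: pasteP => c; split=> [-> | [_ [_ [-> [-> ->]]]]] //.
by exists (Cell2 a), (Cell2 b).
Qed.

Lemma ptensor0 x : pempty # x = pempty.
Proof. by apply: pasteP => c; split=> // -[? [? []]]. Qed.
Lemma ptensorx0 x : x # pempty = pempty.
Proof. by apply: pasteP => c; split=> // -[? [? [_ []]]]. Qed.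

Definition tensor_id2 := forall A A' B B' (f : hom A A') (g : hom B B'),
  F2 T (id2 f) (id2 g) = id2 (F1 T f g).

Context (Tid : tensor_id2).

Lemma ptensor_one A A' B B' (f : hom A A') (g : hom B B') :
  [1 F1 T f g] = [1 f] # [1 g].
Proof. by rewrite -Tid ptensorE. Qed.

Lemma is_one_tensor y x : is_one y -> is_one x -> is_one (y # x).
Proof.
move=> Oy Ox; split; first by apply: subsingleton_tensor; apply: is_one_sub.
case: (is_oneP Oy) => [->|[A [B [f ->]]]]; first by rewrite ptensor0.
case: (is_oneP Ox) => [->|[A' [B' [f' ->]]]]; first by rewrite ptensorx0.
by rewrite -ptensor_one => c ->.
Qed.

Lemma ptensorA : (forall A A' B B' C C'
    (f f' : hom A A') (g g' : hom B B') (h h' : hom C C')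
    (a : hom2 f f') (b : hom2 g g') (c : hom2 h h'),
    Cell2 (F2 T (F2 T a b) c) = Cell2 (F2 T a (F2 T b c))) ->
  forall x y z, z # y # x = z # (y # x).
Proof.
move=> TA x y z; apply: pasteP => w; split.
- move=> [? [a [[c [b [zc [yb ->]]]] [xa ->]]]].
  exists c, (ctensor T b a); split=> //; split; last by apply: TA.
  by exists b, a.
- move=> [c [? [zc [[b [a [yb [xa ->]]]] ->]]]].
  exists (ctensor T c b), a; split; last by split=> //; rewrite /ctensor TA.
  by exists c, b.
Qed.

End Paste.

#[local] Hint Resolve subsingleton_cell subsingleton_hcomp subsingleton_vcomp
  subsingleton_tensor is_one_id is_one_hcomp is_one_tensor
  is_one_sub : paste.

(** * From stringent to quasistrict data *)

Section StringentMonoidal.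

Context {M : TwoCat} (D : stringent_data M) (H : is_stringent_monoidal D).
Implicit Types (A B C : M) (p q r x y z : paste M) (c d : cell2 M).

Local Notation MP := (twocatP M).
Local Notation "A @ B" := (F0 D A B) (at level 38, left associativity).
Local Notation "f # g" := (F1 D f g) (at level 38, left associativity)
  : cell_scope.
Local Notation "x # y" := (ptensor D x y) : paste_scope.
Local Notation "1" := id1 : cell_scope.
Local Notation o A := ([1 id1 A]).

(** * The nudged tensor product is strictly associative *)

Lemma st_tensor_nudge A A' B B' (f f' : hom A A') (g g' : hom B B')
    (a : hom2 f f') (b : hom2 g g') :
  [: a :] # [: b :] = (o A' # [: b :]) \* ([: a :] # o B).
Proof. by rewrite -!ptensorE -phcompE (st_nudge2 H). Qed.

Lemma st_tensor_id2 : tensor_id2 D.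
Proof.
move=> A A' B B' f g; apply: Cell2_inj; rewrite -(st_nudge2 H).
by rewrite (st_L_id2 H) (st_R_id2 H) (hcomp_id MP) (st_nudge1 H).
Qed.

Local Hint Resolve st_tensor_id2 : paste.

Lemma st_one A A' B B' (f : hom A A') (g : hom B B') : [1 f # g] = [1 f] # [1 g].
Proof. by rewrite ptensor_one //; auto with paste. Qed.

Lemma st_o A B : o (A @ B) = o A # o B.
Proof. by rewrite -(st_L_id H) st_one. Qed.

(** The functor L preserves only composites that exist: objects that differ may become equal after
    tensoring with [A]. The cell [c] guarantees that [y \* x] is defined. *)
Lemma st_L_pcomp A c y x : subsingleton y -> subsingleton x ->
  pcell c = y \* x -> o A # pcell c = (o A # y) \* (o A # x).
Proof.
move=> Sy Sx /(phcomp_cell Sy Sx).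
move=> [X [Y [Z [g [g' [f [f' [b [a [-> [-> ->]]]]]]]]]]].
by rewrite -!ptensorE -phcompE (st_L_hcomp H).
Qed.

Lemma st_R_pcomp A c y x : subsingleton y -> subsingleton x ->
  pcell c = y \* x -> pcell c # o A = (y # o A) \* (x # o A).
Proof.
move=> Sy Sx /(phcomp_cell Sy Sx).
move=> [X [Y [Z [g [g' [f [f' [b [a [-> [-> ->]]]]]]]]]]].
by rewrite -!ptensorE -phcompE (st_R_hcomp H).
Qed.

Lemma st_L_hcompE A X Y Z (g g' : hom Y Z) (f f' : hom X Y)
    (b : hom2 g g') (a : hom2 f f') :
  o A # ([: b :] \* [: a :]) = (o A # [: b :]) \* (o A # [: a :]).
Proof. by rewrite -phcompE -!ptensorE -phcompE (st_L_hcomp H). Qed.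

Lemma st_R_hcompE A X Y Z (g g' : hom Y Z) (f f' : hom X Y)
    (b : hom2 g g') (a : hom2 f f') :
  ([: b :] \* [: a :]) # o A = ([: b :] # o A) \* ([: a :] # o A).
Proof. by rewrite -phcompE -!ptensorE -phcompE (st_R_hcomp H). Qed.

(** Nudging turns both sides into horizontal composites of three factors, one for each of [c], [b],
    [a]; these agree by the commutation of the functors L with L, L with R, and R with R. *)
Lemma st_tensor_assoc2 A A' B B' C C'
    (f f' : hom A A') (g g' : hom B B') (h h' : hom C C')
    (a : hom2 f f') (b : hom2 g g') (c : hom2 h h') :
  Cell2 (F2 D (F2 D a b) c) = Cell2 (F2 D a (F2 D b c)).
Proof.
have LL X Y d : o X # (o Y # pcell d) = o (X @ Y) # pcell d.
  by case: d => ? ? ? ? d; rewrite -!ptensorE (st_LL2 H).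
have RR X Y d : (pcell d # o X) # o Y = pcell d # o (X @ Y).
  by case: d => ? ? ? ? d; rewrite -!ptensorE (st_RR2 H).
have LR X Y d : o X # (pcell d # o Y) = o X # pcell d # o Y.
  by case: d => ? ? ? ? d; rewrite -!ptensorE (st_LR2 H).
apply: pcell_inj; rewrite (ptensorE D (F2 D a b)) (st_tensor_nudge (F2 D a b)).
rewrite (ptensorE D a (F2 D b c)) (st_tensor_nudge a).
have E1 := ptensorE D a b; have E2 := ptensorE D b c.
rewrite (st_tensor_nudge a) in E1; rewrite (st_tensor_nudge b) in E2.
rewrite (st_R_pcomp C _ _ E1) ?(st_L_pcomp A' _ _ E2); auto with paste.
by rewrite LL LR RR phcompA.
Qed.

Lemma st_tensorA x y z : z # y # x = z # (y # x).
Proof. by apply: ptensorA; apply: st_tensor_assoc2. Qed.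

Lemma st_tensor_assoc1 A A' B B' C C'
    (f : hom A A') (g : hom B B') (h : hom C C') :
  Cell1 (f # g # h)%cell = Cell1 (f # (g # h))%cell.
Proof. by apply: Cell1_of_id; apply: pcell_inj; rewrite !st_one st_tensorA. Qed.

(** * Interchangors with typed boundaries *)

Definition st_phi A A' B B' (f : hom A A') (g : hom B B') :
    hom2 ((f # 1 B') \o (1 A # g))%cell ((1 A' # g) \o (f # 1 B))%cell :=
  proj1_sig (cell2_with_boundary (st_phi_src H f g) (st_phi_tgt H f g)).

Lemma st_phiE A A' B B' (f : hom A A') (g : hom B B') :
  Cell2 (st_phi f g) = phi D f g.
Proof. exact: (proj2_sig (cell2_with_boundary _ _)). Qed.

Lemma st_phi_inv A A' B B' (f : hom A A') (g : hom B B') :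
  exists b, inverse2 (st_phi f g) b.
Proof. by have := st_phi_iso H f g; rewrite -st_phiE. Qed.

Local Notation p f g := ([: st_phi f g :]).

Lemma st_phi_nat A A' B B' (f f' : hom A A') (g g' : hom B B')
    (a : hom2 f f') (c : hom2 g g') :
  (st_phi f' g' \v (F2 D a (id2 (1 B')) \* F2 D (id2 (1 A)) c)
   = (F2 D (id2 (1 A')) c \* F2 D a (id2 (1 B))) \v st_phi f g)%cell.
Proof.
have /peqE N1 := st_phi_natl H g' a; have /peqE N2 := st_phi_natr H f c.
rewrite -!st_phiE -!phcompE -!pvcompE in N1 N2.
have {}N1 : _ := Cell2_inj (pcell_inj (N1 _ _)).
have {}N2 : _ := Cell2_inj (pcell_inj (N2 _ _)).
(* Inserting identities splits the joint move into one along [a] followed by one along [c], to which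
   the separate naturality laws apply. *)
rewrite -[F2 D a (id2 (1 B'))](vcomp_idr MP) -[F2 D (id2 (1 A)) c](vcomp_idl MP).
rewrite (interchange MP) (vcomp_assoc MP) N1; auto with paste.
rewrite -(vcomp_assoc MP) N2; auto with paste.
rewrite (vcomp_assoc MP) -(interchange MP).
by rewrite (vcomp_idl MP) (vcomp_idr MP).
Qed.

Lemma st_phi_comprE A A' B B' B'' (f : hom A A') (g : hom B B') (g' : hom B' B'') :
  p f (g' \o g) = ((o A' # [1 g']) \* p f g) \v (p f g' \* (o A # [1 g])).
Proof.
have := st_phi_compr H f g g'; rewrite -!st_phiE !st_one.
by apply: peqE; auto 6 with paste.
Qed.

Lemma st_phi_complE A A' A'' B B' (f : hom A A') (f' : hom A' A'') (g : hom B B') :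
  p (f' \o f) g = (p f' g \* ([1 f] # o B)) \v (([1 f'] # o B') \* p f g).
Proof.
have := st_phi_compl H f f' g; rewrite -!st_phiE !st_one.
by apply: peqE; auto 6 with paste.
Qed.

Lemma st_phi_psrc A A' B B' (f : hom A A') (g : hom B B') :
  psrc (p f g) = ([1 f] # o B') \* (o A # [1 g]).
Proof. by rewrite psrc_cell pcompE !st_one. Qed.

Lemma st_phi_ptgt A A' B B' (f : hom A A') (g : hom B B') :
  ptgt (p f g) = (o A' # [1 g]) \* ([1 f] # o B).
Proof. by rewrite ptgt_cell pcompE !st_one. Qed.

(** * The cubical functor determined by the interchangors *)

Lemma st_Phi_sig A A' A'' B B' B''
    (f' : hom A' A'') (g' : hom B' B'') (f : hom A A') (g : hom B B') :
  {a : hom2 ((f' # g') \o (f # g))%cell ((f' \o f) # (g' \o g))%cell |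
   Cell2 a = Cell2 (id2 (1 A'' # g') \* st_phi f' g \* id2 (f # 1 B))%cell}.
Proof.
apply: cell2_with_boundary; rewrite /src /tgt /=; congr Cell1.
  by rewrite -(st_nudge1 H f' g') -(st_nudge1 H f g) !(comp_assoc MP).
rewrite -(st_nudge1 H (f' \o f)%cell (g' \o g)%cell) (st_L_comp H) (st_R_comp H).
by rewrite !(comp_assoc MP).
Qed.

(** The whiskering of [st_phi f' g] has the required boundaries only up to nudging and functoriality
    of L and R, hence the transport; [st_PhiE] recovers the formula. *)
Definition st_Phi : bifun_coherence D := fun A A' A'' B B' B'' f' g' f g =>
  proj1_sig (st_Phi_sig f' g' f g).

Lemma st_PhiE A A' A'' B B' B''
    (f' : hom A' A'') (g' : hom B' B'') (f : hom A A') (g : hom B B') :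
  [: st_Phi f' g' f g :] = (o A'' # [1 g']) \* (p f' g \* ([1 f] # o B)).
Proof.
rewrite /st_Phi (proj2_sig (st_Phi_sig f' g' f g)).
by rewrite !phcompE phcompA !st_one.
Qed.

Lemma st_one_nudge A A' B B' (f : hom A A') (g : hom B B') :
  [1 f # g] = (o A' # [1 g]) \* ([1 f] # o B).
Proof. by rewrite st_one st_tensor_nudge. Qed.

(** Expanding phi_{f''f',g} on the left and phi_{f'',g'g} on the right exhibits three interchangors
    on each side. Both end with phi_{f'',g}; the other two, phi_{f'',g'} and phi_{f',g}, occur in
    opposite orders and are exchanged. *)
Lemma st_pf_assoc A A' A'' A''' B B' B'' B'''
    (f'' : hom A'' A''') (g'' : hom B'' B''') (f' : hom A' A'')
    (g' : hom B' B'') (f : hom A A') (g : hom B B') :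
    Cell2 (st_Phi (f'' \o f') (g'' \o g') f g
           \v (st_Phi f'' g'' f' g' \* id2 (F1 D f g)))%cell
    = Cell2 (st_Phi f'' g'' (f' \o f) (g' \o g)
             \v (id2 (F1 D f'' g'') \* st_Phi f' g' f g))%cell.
Proof.
apply: pcell_inj; rewrite !pvcompE !phcompE !st_PhiE !st_one_nudge !pcompE.
rewrite st_L_hcompE st_R_hcompE.
have E1 := st_phi_complE f' f'' g; have E2 := st_phi_comprE f'' g g'.
rewrite (whisker _ _ _ _ E1); auto with paste.
rewrite (whisker _ _ _ _ E2); auto with paste.
rewrite !phcompA !pvcompA; congr pvcomp.
have := whiskered_exchange (k := o A''' # [1 g'']) (m := [1 f] # o B)
  (y := p f'' g') (x := p f' g).
by rewrite !st_phi_psrc !st_phi_ptgt !phcompA; apply; auto with paste.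
Qed.

Lemma st_tensor_hcomp A A' A'' B B' B'' (f' f1' : hom A' A'') (f f1 : hom A A')
    (g' g1' : hom B' B'') (g g1 : hom B B')
  (a' : hom2 f' f1') (a : hom2 f f1) (c' : hom2 g' g1') (c : hom2 g g1) :
  [: a' \* a :] # [: c' \* c :] =
  (o A'' # [: c' :]) \* ((o A'' # [: c :]) \* (([: a' :] # o B) \* ([: a :] # o B))).
Proof.
by rewrite st_tensor_nudge !phcompE st_L_hcompE st_R_hcompE phcompA.
Qed.

Lemma st_phi_id_r A A' B (f : hom A A') : p f (1 B) = [1 f # 1 B].
Proof.
have := st_phi_idr H B f; rewrite -st_phiE => /identityE [-> _].
by rewrite (st_L_id H) (comp_idr MP).
Qed.

Lemma st_phi_id_l A B B' (g : hom B B') : p (1 A) g = [1 1 A # g].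
Proof.
have := st_phi_idl H A g; rewrite -st_phiE => /identityE [-> _].
by rewrite (st_R_id H) (comp_idl MP).
Qed.

(** A whiskering of an identity is an identity. The unit axioms, cubicality and (QS.3) all reduce to
    this, since [g'] and [f] enter only through the whiskering. *)
Lemma st_Phi_identity A A' A'' B B' B''
    (f' : hom A' A'') (g' : hom B' B'') (f : hom A A') (g : hom B B') :
  is_identity (phi D f' g) -> is_identity (Cell2 (st_Phi f' g' f g)).
Proof.
rewrite -st_phiE => /identityE [E _].
have := st_PhiE f' g' f g; rewrite E -!st_one -!pcompE.
by apply: is_identityE.
Qed.

Lemma st_pseudofunctor : is_pseudofunctor st_Phi.
Proof.
split.
- exact: st_tensor_id2.
- move=> A A' B B' f f' f'' g g' g'' a' a c' c; apply: Cell2_inj.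
  rewrite -(st_nudge2 H) (st_L_vcomp H) (st_R_vcomp H) (interchange MP).
  apply: pcell_inj; rewrite !pvcompE !phcompE !ptensorE.
  by rewrite -!st_tensor_nudge.
- by move=> A B; apply: (st_L_id H).
- move=> A A' A'' B B' B'' f' g' f g; have [b [Hb1 Hb2]] := st_phi_inv f' g.
  rewrite /st_Phi; rewrite (proj2_sig (st_Phi_sig f' g' f g)) /invertible /=.
  exists (id2 (1 A'' # g') \* b \* id2 (f # 1 B))%cell.
  by split; rewrite -!(interchange MP) ?Hb1 ?Hb2 !(vcomp_idl MP) !(hcomp_id MP).
- move=> A A' A'' B B' B'' f' k' g' l' f k g l a' c' a c.
  apply: Cell2_inj; apply: pcell_inj.
  rewrite !pvcompE phcompE !ptensorE st_tensor_hcomp.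
  rewrite (st_tensor_nudge a' c') (st_tensor_nudge a c).
  rewrite !(proj2_sig (st_Phi_sig _ _ _ _)).
  (* Rebracketing brings the factors of [a'] and [c] together in the middle, so that naturality of
     phi moves them past the interchangor while [c'] and [a] only meet identities. *)
  transitivity [: (id2 (1 A'' # l') \* st_phi k' l \* id2 (k # 1 B)) \v
    (F2 D (id2 (1 A'')) c' \* (F2 D a' (id2 (1 B')) \* F2 D (id2 (1 A')) c)
     \* F2 D a (id2 (1 B))) :].
    by rewrite pvcompE !phcompE !ptensorE !phcompA.
  rewrite -!(interchange MP) st_phi_nat !(vcomp_idl MP).
  rewrite -{1}[F2 D (id2 (1 A'')) c'](vcomp_idr MP).
  rewrite -{1}[F2 D a (id2 (1 B))](vcomp_idr MP).
  by rewrite !(interchange MP) pvcompE !phcompE !ptensorE !phcompA.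
- by move=> A A' B B' f g; apply: st_Phi_identity; apply: (st_phi_idl H).
- by move=> A A' B B' f g; apply: st_Phi_identity; apply: (st_phi_idr H).
- exact: st_pf_assoc.
Qed.

Lemma st_cubical : is_cubical st_Phi.
Proof.
split; first exact: st_pseudofunctor.
- by move=> A A' B B' B'' g' f g; apply: st_Phi_identity; apply: (st_phi_idl H).
- by move=> A A' A'' B B' f' g' f; apply: st_Phi_identity; apply: (st_phi_idr H).
Qed.

(** * Compatibility with associativity and units: the Gray monoid *)

Lemma st_phi_LE A B B' C C' (g : hom B B') (h : hom C C') :
  p (1 A # g) h = o A # p g h.
Proof. by rewrite -ptensorE st_phiE (st_phi_L H) -st_phiE. Qed.

Lemma st_phi_LRE A A' B C C' (f : hom A A') (h : hom C C') :
  p (f # 1 B) h = p f (1 B # h).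
Proof. by rewrite !st_phiE (st_phi_LR H). Qed.

Lemma st_phi_RE A A' B B' C (f : hom A A') (g : hom B B') :
  p f (g # 1 C) = p f g # o C.
Proof. by rewrite -ptensorE st_phiE (st_phi_R H) -st_phiE. Qed.

Lemma st_Phi_R A A' A'' B B' B'' C
    (f' : hom A' A'') (g' : hom B' B'') (f : hom A A') (g : hom B B') :
  [: st_Phi f' g' f g :] # o C =
  (o A'' # ([1 g'] # o C)) \* ((p f' g # o C) \* ([1 f] # (o B # o C))).
Proof.
rewrite /st_Phi (proj2_sig (st_Phi_sig f' g' f g)).
by rewrite phcompE st_R_hcompE phcompE st_R_hcompE phcompA !st_one !st_tensorA.
Qed.

Lemma st_Phi_L A A' A'' B B' B'' C
    (f' : hom A' A'') (g' : hom B' B'') (f : hom A A') (g : hom B B') :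
  o C # [: st_Phi f' g' f g :] =
  (o C # (o A'' # [1 g'])) \* ((o C # p f' g) \* (o C # ([1 f] # o B))).
Proof.
rewrite /st_Phi (proj2_sig (st_Phi_sig f' g' f g)).
by rewrite phcompE st_L_hcompE phcompE st_L_hcompE phcompA !st_one.
Qed.

Lemma st_one_nudge_R A A' B B' C (f : hom A A') (g : hom B B') :
  [1 f # g] # o C = (o A' # ([1 g] # o C)) \* ([1 f] # (o B # o C)).
Proof. by rewrite -(st_nudge1 H) pcompE st_R_hcompE !st_one !st_tensorA. Qed.

Lemma st_one_nudge_L A A' B B' C (f : hom A A') (g : hom B B') :
  o C # [1 f # g] = (o C # (o A' # [1 g])) \* (o C # ([1 f] # o B)).
Proof. by rewrite -(st_nudge1 H) pcompE st_L_hcompE !st_one. Qed.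

(** Nudging writes [f' # g'] and [g # h] as composites, along which phi expands. Both sides then
    start with phi_{f'#1,h} = phi_{f',1#h}; what remains is the exchange of phi_{1#g',h} and
    phi_{f',g#1}, which are the tensored forms of phi_{g',h} and phi_{f',g}. *)
Lemma st_gray_assocPhi A A' A'' B B' B'' C C' C''
    (f' : hom A' A'') (g' : hom B' B'') (h' : hom C' C'')
    (f : hom A A') (g : hom B B') (h : hom C C') :
    Cell2 (F2 D (st_Phi f' g' f g) (id2 (h' \o h))
           \v st_Phi (F1 D f' g') h' (F1 D f g) h)%cell
    = Cell2 (F2 D (id2 (f' \o f)) (st_Phi g' h' g h)
             \v st_Phi f' (F1 D g' h') f (F1 D g h))%cell.
Proof.
apply: pcell_inj; rewrite !pvcompE !ptensorE (st_tensor_nudge (st_Phi f' g' f g)).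
rewrite (st_tensor_nudge (id2 (f' \o f)%cell)) st_Phi_R st_Phi_L !pcompE.
rewrite st_L_hcompE st_R_hcompE !st_PhiE st_one_nudge_L st_one_nudge_R.
have E1 := st_phi_complE (f' # 1 B')%cell (1 A'' # g')%cell h.
have E2 := st_phi_comprE f' (g # 1 C)%cell (1 B' # h)%cell.
rewrite -(st_nudge1 H f' g') -(st_nudge1 H g h).
rewrite (whisker _ _ _ _ E1); auto 6 with paste.
rewrite (whisker _ _ _ _ E2); auto 6 with paste.
rewrite !phcompA -!pvcompA -st_phi_LE -st_phi_RE st_phi_LRE.
rewrite !st_one !st_o !st_tensorA; congr pvcomp.
have := whiskered_exchange (k := o (A'' @ B'') # [1 h']) (m := [1 f] # o (B @ C))
  (y := p (1 A'' # g')%cell h) (x := p f' (g # 1 C)%cell).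
rewrite !st_phi_psrc !st_phi_ptgt !st_one !st_o !st_tensorA !phcompA.
by apply; auto with paste.
Qed.

Lemma st_unitl A A' (f f' : hom A A') (a : hom2 f f') : o (one D) # [: a :] = [: a :].
Proof. by rewrite -ptensorE (st_L1_2 H). Qed.

Lemma st_unitr A A' (f f' : hom A A') (a : hom2 f f') : [: a :] # o (one D) = [: a :].
Proof. by rewrite -ptensorE (st_R1_2 H). Qed.

Lemma st_gray_monoid : is_gray_monoid st_Phi.
Proof.
split.
- exact: st_cubical.
- exact: (st_assoc0 H).
- exact: (st_unitl0 H).
- exact: (st_unitr0 H).
- by move=> *; apply: st_tensor_assoc1.
- exact: (st_L1_1 H).
- exact: (st_R1_1 H).
- by move=> *; apply: st_tensor_assoc2.
- exact: (st_L1_2 H).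
- exact: (st_R1_2 H).
- by move=> *; apply: st_gray_assocPhi.
- move=> A A' A'' f' f; apply: pcell_inj.
  rewrite st_PhiE st_phi_id_l st_one -st_o (st_unitl0 H) !st_unitl.
  by rewrite phcomp1r pcompE.
- move=> A A' A'' f' f; apply: pcell_inj.
  rewrite st_PhiE st_phi_id_r st_one -st_o (st_unitr0 H) !st_unitr.
  by rewrite -phcompA phcomp1l pcompE.
Qed.

(** * The braiding and its 2-morphism components *)

Context (HS : is_stringent_symmetric D).
Local Notation b := (st_beta D).
Local Notation bt A B := ([1 b A B]).

Lemma st_beta_natl A A' B (f : hom A A') :
  bt A' B \* ([1 f] # o B) = (o B # [1 f]) \* bt A B.
Proof. by rewrite -!st_one -!pcompE (st_natl HS). Qed.

Lemma st_beta_natr A B B' (g : hom B B') :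
  bt A B' \* (o A # [1 g]) = ([1 g] # o A) \* bt A B.
Proof. by rewrite -!st_one -!pcompE (st_natr HS). Qed.

Lemma st_beta_natlA A A' B (f : hom A A') x :
  bt A' B \* (([1 f] # o B) \* x) = (o B # [1 f]) \* (bt A B \* x).
Proof. by rewrite -!phcompA st_beta_natl. Qed.

Lemma st_beta_natrA A B B' (g : hom B B') x :
  bt A B' \* ((o A # [1 g]) \* x) = ([1 g] # o A) \* (bt A B \* x).
Proof. by rewrite -!phcompA st_beta_natr. Qed.

Lemma st_beta_hexl A B C : bt (A @ B) C = (bt A C # o B) \* (o A # bt B C).
Proof. by rewrite (is_comp1E (st_hexl HS A B C)) !st_one. Qed.

Lemma st_beta_hexr A B C : bt A (B @ C) = (o B # bt A C) \* (bt A B # o C).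
Proof. by rewrite (is_comp1E (st_hexr HS A B C)) !st_one. Qed.

Lemma st_phi_beta_rs A A' B C (f : hom A A') :
  p f (b B C) = ([1 f] # o (C @ B)) \* (o A # bt B C).
Proof.
have := st_phi_betar HS B C f; rewrite -st_phiE => /identityE [-> _].
by rewrite pcompE !st_one.
Qed.

Lemma st_phi_beta_rt A A' B C (f : hom A A') :
  p f (b B C) = (o A' # bt B C) \* ([1 f] # o (B @ C)).
Proof.
have := st_phi_betar HS B C f; rewrite -st_phiE => /identityE [-> ->].
by rewrite pcompE !st_one.
Qed.

Lemma st_phi_beta_ls A B C C' (g : hom C C') :
  p (b A B) g = (bt A B # o C') \* (o (A @ B) # [1 g]).
Proof.
have := st_phi_betal HS A B g; rewrite -st_phiE => /identityE [-> _].
by rewrite pcompE !st_one.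
Qed.

Lemma st_phi_beta_lt A B C C' (g : hom C C') :
  p (b A B) g = (o (B @ A) # [1 g]) \* (bt A B # o C).
Proof.
have := st_phi_betal HS A B g; rewrite -st_phiE => /identityE [-> ->].
by rewrite pcompE !st_one.
Qed.

(** In the composition law of phi the factor involving the braiding is an identity, hence equal to
    the adjacent boundary of the other factor, which absorbs it. The next three lemmas are the
    variants for the other side and the other variable. *)
Lemma st_phi_precomp_betar A A' B C X (f : hom A A') (g : hom (C @ B) X) :
  p f (g \o b B C) = p f g \* (o A # bt B C).
Proof.
rewrite st_phi_comprE st_phi_beta_rs.
set x := (X in _ \v X); rewrite -[RHS]pvcomp_tgt; first by auto with paste.
congr pvcomp; rewrite /x ptgt_hcomp ?st_phi_ptgt ?ptgt_one ?phcompA; auto with paste.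
Qed.

Lemma st_phi_postcomp_betar A A' B C X (f : hom A A') (g : hom X (B @ C)) :
  p f (b B C \o g) = (o A' # bt B C) \* p f g.
Proof.
rewrite st_phi_comprE st_phi_beta_rt -[RHS]pvcomp_src; first by auto with paste.
congr pvcomp; rewrite psrc_hcomp ?st_phi_psrc ?psrc_one ?phcompA; auto with paste.
Qed.

Lemma st_phi_precomp_betal A B C C' X (f : hom (B @ A) X) (g : hom C C') :
  p (f \o b A B) g = p f g \* (bt A B # o C).
Proof.
rewrite st_phi_complE st_phi_beta_lt -[RHS]pvcomp_src; first by auto with paste.
congr pvcomp; rewrite psrc_hcomp ?st_phi_psrc ?psrc_one ?phcompA; auto with paste.
Qed.

Lemma st_phi_postcomp_betal A B C C' X (f : hom X (A @ B)) (g : hom C C') :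
  p (b A B \o f) g = (bt A B # o C') \* p f g.
Proof.
rewrite st_phi_complE st_phi_beta_ls -[RHS]pvcomp_tgt; first by auto with paste.
congr pvcomp; rewrite ptgt_hcomp ?st_phi_ptgt ?ptgt_one ?phcompA; auto with paste.
Qed.

(** The source of the whiskered interchangor is brought to the required form by moving the braiding
    past [f] and then past [g]; the target is a nudging. *)
Lemma st_beta2_sig A A' B B' (f : hom A A') (g : hom B B') :
  {a : hom2 ((g # f) \o b A B)%cell (b A' B' \o (f # g))%cell |
   Cell2 a = Cell2 (id2 (b A' B') \* st_phi f g)%cell}.
Proof.
apply: cell2_with_boundary; rewrite /src /tgt /=; congr Cell1; last first.
  by rewrite (st_nudge1 H).
rewrite -(st_nudge1 H g f) (comp_assoc MP) (st_natl HS) -(comp_assoc MP).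
by rewrite (st_natr HS) (comp_assoc MP).
Qed.

Definition st_beta2 A A' B B' (f : hom A A') (g : hom B B') :=
  proj1_sig (st_beta2_sig f g).

Lemma st_beta2E A A' B B' (f : hom A A') (g : hom B B') :
  [: st_beta2 f g :] = bt A' B' \* p f g.
Proof. by rewrite /st_beta2 (proj2_sig (st_beta2_sig f g)) phcompE. Qed.

Lemma st_sigma_sig A B :
  {a : hom2 (1 (A @ B)) (b B A \o b A B)%cell | Cell2 a = Cell2 (id2 (1 (A @ B)))}.
Proof. by apply: cell2_with_boundary => //; rewrite (st_sym HS). Qed.

(** The modifications are identities. By the hexagons the identities of beta_{A@B,C} and
    beta_{A,B@C} also have the composites required of R and S as targets; sigma is transported along
    the symmetry equation. *)
Definition st_symmon : symmon_data M :=
  {| sm_tensor := D; Phi := st_Phi; beta := b; beta2 := st_beta2;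
     modR := fun A B C => Cell2 (id2 (b (A @ B) C));
     modS := fun A B C => Cell2 (id2 (b A (B @ C)));
     sigma := fun A B => proj1_sig (st_sigma_sig A B) |}.

Lemma st_sigmaE A B : [: sigma st_symmon A B :] = o (A @ B).
Proof. by rewrite /= (proj2_sig (st_sigma_sig A B)). Qed.

(** * Axioms of the braiding transformation *)

Context (HN : is_braiding_natural D).

Lemma st_beta_natl2 A A' B (f f' : hom A A') (a : hom2 f f') :
  bt A' B \* ([: a :] # o B) = (o B # [: a :]) \* bt A B.
Proof. by rewrite -!ptensorE -!phcompE (st_natl2 HN). Qed.

Lemma st_beta_natr2 A B B' (g g' : hom B B') (c : hom2 g g') :
  bt A B' \* (o A # [: c :]) = ([: c :] # o A) \* bt A B.
Proof. by rewrite -!ptensorE -!phcompE (st_natr2 HN). Qed.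

Lemma st_beta_sym A B : bt B A \* bt A B = o (A @ B).
Proof. by rewrite -pcompE (st_sym HS). Qed.

Lemma st_beta_phiE A A' B B' (f : hom A A') (g : hom B B') :
  [1 b A' B' \o ((f # 1 B') \o (1 A # g))]
  = (p g f \* bt A B) \v (bt A' B' \* p f g).
Proof.
have := st_beta_phi HN f g; rewrite -!st_phiE => /peqE -> ; auto 7 with paste.
by rewrite !pcompE phcompA.
Qed.

(* This is [st_beta_phiE] for (g, f), conjugated by the braiding. *)
Lemma st_phi_beta_inv A A' B B' (f : hom A A') (g : hom B B') :
  [1 (g # 1 A') \o (1 B # f) \o b A B]
  = (bt A' B' \* p f g) \v (p g f \* bt A B).
Proof.
have E := st_beta_phiE g f.
have := whisker (k := bt A' B') (m := bt A B) _ _ _ _ E.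
rewrite !phcompA st_beta_sym phcomp1r -(phcompA _ (bt B' A')) st_beta_sym.
rewrite -(phcompA _ (p g f)) phcomp1l -!pcompE => <-; auto with paste.
by rewrite !(comp_assoc MP) (st_sym HS) (comp_idl MP).
Qed.

(** The interchangor of [f' \o f] and [g' \o g] expands into four. One of them, phi_{f,g'}, cancels
    against the phi_{g',f} inside Phi_{(g',f'),(g,f)}; the other three are the factors on the
    right. *)
Lemma st_beta2_comp A A' A'' B B' B''
    (f' : hom A' A'') (g' : hom B' B'') (f : hom A A') (g : hom B B') :
  [: st_beta2 (f' \o f) (g' \o g) :] \v ([: st_Phi g' f' g f :] \* bt A B)
  = (bt A'' B'' \* [: st_Phi f' g' f g :]) \v ([: st_beta2 f' g' :] \* [1 f # g])
    \v ([1 g' # f'] \* [: st_beta2 f g :]).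
Proof.
rewrite !st_beta2E !st_PhiE !st_one_nudge.
have E1 := st_phi_complE f f' (g' \o g)%cell.
have E2 := st_phi_comprE f' g g'; have E3 := st_phi_comprE f g g'.
rewrite (whiskerl (k := bt A'' B'') _ _ _ E1); auto with paste.
rewrite (whisker _ _ _ _ E2); auto with paste.
rewrite -(phcompA (p f (g' \o g)%cell)).
rewrite (whiskerl _ _ _ E3); auto with paste.
(* The cancellation of phi_{f,g'} with phi_{g',f}, whiskered into place. *)
have E4 := st_phi_beta_inv f g'.
have := whisker (k := o B'' # [1 f']) (m := o A # [1 g]) _ _ _ _ E4.
rewrite !phcompA !pvcompA -st_beta_natr !st_beta_natlA => <-; auto with paste.
do 2 congr pvcomp.
(* The cancelled pair has left an identity, which has to be recognised as the source of the
   remaining bottom factor. *)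
rewrite !pcompE !st_one -[RHS]pvcomp_src; auto with paste.
rewrite !phcompA !st_beta_natrA; congr pvcomp.
rewrite !psrc_hcomp ?st_phi_psrc; auto 6 with paste.
by rewrite !psrc_one ?st_beta_natlA; auto with paste.
Qed.

Lemma st_braiding : is_braiding_transformation st_symmon.
Proof.
split.
- move=> A A' B B' f g; have [a [V1 V2]] := st_phi_inv f g.
  rewrite /= (proj2_sig (st_beta2_sig f g)) /invertible /=.
  exists (id2 (b A' B') \* a)%cell.
  by split; rewrite -!(interchange MP) ?V1 ?V2 !(vcomp_idl MP) !(hcomp_id MP).
- move=> A A' B B' f f' g g' a c /=; apply: Cell2_inj; apply: pcell_inj.
  rewrite !pvcompE !phcompE !ptensorE !st_beta2E.
  rewrite (st_tensor_nudge a c) (st_tensor_nudge c a) !phcompA.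
  rewrite -st_beta_natr2 -!(phcompA _ (bt A B')) -st_beta_natl2.
  rewrite -!ptensorE !phcompA -!phcompE -!pvcompE -!(interchange MP).
  by rewrite st_phi_nat.
- move=> A B /=; apply: (@is_identityE _ _ _ _ _ _ _ _ (b A B)).
  by rewrite st_beta2E st_phi_id_r (st_R_id H) phcomp1r.
- move=> A A' A'' B B' B'' f' g' f g /=.
  rewrite -st_beta2_comp -phcompE -pvcompE.
  exact: peq_refl.
Qed.

(** * Modifications, coherence and unit axioms *)

Lemma st_beta2_tensorl A A' B B' C C' (f : hom A A') (g : hom B B') (h : hom C C') :
  beta2_tensorl st_symmon f g h
  = (o A' # bt B' C') \* ((o A' # p g h) \* ([1 f] # o (B @ C))).
Proof.
rewrite /beta2_tensorl /=.
have /identityE [-> E1] := st_Phi_identity (b B' C') f (st_phi_idl H A' (g # h)%cell).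
have /identityE [-> E2] := st_Phi_identity (h # g)%cell (1 A) (st_phi_betar HS B C f).
rewrite pinv_one; auto with paste; rewrite {}E1 {}E2 -ptensorE.
rewrite (comp_idl MP) (comp_idr MP) pvcomp1l pvcomp1r ptensorE st_tensor_nudge.
have E := st_beta2E g h.
by rewrite (st_L_pcomp _ _ _ E) ?phcompA; auto with paste.
Qed.

Lemma st_beta2_tensorr A A' B B' C C' (f : hom A A') (g : hom B B') (h : hom C C') :
  beta2_tensorr st_symmon f g h
  = (o (B' @ A') # [1 h]) \* ((bt A' B' # o C) \* (p f g # o C)).
Proof.
rewrite /beta2_tensorr /=.
have /identityE [-> E1] := st_Phi_identity (1 C') (f # g)%cell (st_phi_betal HS A' B' h).
have /identityE [-> E2] := st_Phi_identity h (b A B) (st_phi_idr H C (g # f)%cell).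
rewrite pinv_one; auto with paste; rewrite {}E1 {}E2 -ptensorE.
rewrite (comp_idl MP) (comp_idr MP) pvcomp1l pvcomp1r ptensorE st_tensor_nudge.
have E := st_beta2E f g.
by rewrite (st_R_pcomp _ _ _ E) ?phcompA; auto with paste.
Qed.

(** With R an identity its modification axiom becomes this equation. The interchangor of [f # g]
    with [h] splits by nudging into phi_{1#g,h} and phi_{f#1,h}; the first matches at once, the
    second after sliding braidings through phi. *)
Lemma st_R_natural A A' B B' C C' (f : hom A A') (g : hom B B') (h : hom C C') :
  ((bt A' C' # o B') \* beta2_tensorl st_symmon f g h)
  \v (beta2_tensorr st_symmon f h g \* (o A # bt B C))
  = [: st_beta2 (f # g) h :].
Proof.
rewrite st_beta2E st_beta2_tensorl st_beta2_tensorr.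
have E := st_phi_complE (f # 1 B)%cell (1 A' # g)%cell h.
rewrite -(st_nudge1 H f g) (whiskerl _ _ _ E); auto with paste.
rewrite st_phi_LE st_phi_LRE !st_one !st_o !st_tensorA st_beta_hexl !phcompA.
congr pvcomp.
(* The braiding of [B] and [C] is absorbed into the second argument of phi, moved past [h] by
   naturality and released on the other side. *)
rewrite -st_phi_RE -st_phi_precomp_betar -(st_natr HS) st_phi_postcomp_betar.
(* Source and target of the identity phi_{beta,g} coincide, so the braiding and [g] may trade
   places. *)
have Ex := st_phi_beta_ls A' C' g; rewrite st_phi_beta_lt !st_o !st_tensorA in Ex.
rewrite -phcompA {}Ex !phcompA; congr phcomp; rewrite -!phcompA; congr phcomp.
by rewrite -!st_one -!pcompE -!(st_L_comp H) (st_natl HS).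
Qed.

(** The mirror image of [st_R_natural]: phi is expanded in its second argument, and the braiding
    slides through the first. *)
Lemma st_S_natural A A' B B' C C' (f : hom A A') (g : hom B B') (h : hom C C') :
  ((o B' # bt A' C') \* beta2_tensorr st_symmon f g h)
  \v (beta2_tensorl st_symmon g f h \* (bt A B # o C))
  = [: st_beta2 f (g # h) :].
Proof.
rewrite st_beta2E st_beta2_tensorl st_beta2_tensorr.
have E := st_phi_comprE f (g # 1 C)%cell (1 B' # h)%cell.
rewrite -(st_nudge1 H g h) (whiskerl _ _ _ E); auto with paste.
rewrite st_phi_RE !st_one !st_o !st_tensorA st_beta_hexr !phcompA.
congr pvcomp; congr phcomp.
  have Ex := st_phi_beta_ls A' B' h; rewrite st_phi_beta_lt !st_o !st_tensorA in Ex.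
  by rewrite -phcompA {}Ex !phcompA.
rewrite -st_phi_LRE -(phcompA _ _ (bt A' B' # o C')) -st_phi_postcomp_betal (st_natl HS).
rewrite st_phi_precomp_betal st_phi_LE !phcompA; congr phcomp.
rewrite -!(st_tensorA _ _ [1 g]) -!(st_tensorA _ _ (o A)).
by rewrite -!st_one -!pcompE -!(st_R_comp H) (st_natr HS).
Qed.

Lemma st_modifications : are_modifications st_symmon.
Proof.
split=> //=.
- exact: (st_hexl HS).
- by move=> A B C; exists (id2 (b (A @ B) C)); split; rewrite (vcomp_idl MP).
- move=> A A' B B' C C' f g h.
  have E := st_R_natural f g h.
  apply: (@peq_refl _ (Cell2 (st_beta2 (f # g)%cell h))).
    by rewrite -pcompE pvcomp1l.
  by rewrite !st_one {}E -!st_one -pcompE pvcomp1r.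
- exact: (st_hexr HS).
- by move=> A B C; exists (id2 (b A (B @ C))); split; rewrite (vcomp_idl MP).
- move=> A A' B B' C C' f g h.
  have E := st_S_natural f g h.
  apply: (@peq_refl _ (Cell2 (st_beta2 f (g # h)%cell))).
    by rewrite -pcompE pvcomp1l.
  by rewrite !st_one {}E -!st_one -pcompE pvcomp1r.
- move=> A B; rewrite (proj2_sig (st_sigma_sig A B)).
  by exists (id2 (1 (A @ B))); split; rewrite (vcomp_idl MP).
- move=> A A' B B' f g; rewrite !(proj2_sig (st_sigma_sig _ _)) !st_beta2E.
  apply: (@peq_refl _ (Cell2 (id2 (f # g)%cell))); first by rewrite phcomp1l.
  rewrite phcomp1r -!phcompA st_beta_sym phcomp1l.
  (* Once sigma is an identity, its modification axiom is the inverse relation between phi_{f,g} and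
     phi_{g,f}, whiskered with the braiding. *)
  have E := st_beta_phiE g f.
  have := whiskerr (k := bt A B) _ _ _ E; rewrite !phcompA st_beta_sym phcomp1r => <-;
    auto with paste.
  rewrite -pcompE !(comp_assoc MP) (st_natl HS) -(comp_assoc MP (1 A' # g)%cell).
  rewrite (st_natr HS) -!(comp_assoc MP) (st_sym HS) (comp_idr MP) (st_nudge1 H).
  by rewrite pvcomp1l.
Qed.

(** Every cell involved is an identity, so each axiom compares two identity 2-morphisms; their
    1-morphisms agree by hexagons, naturality and symmetry of the braiding. *)
Lemma st_coherent : is_symmetric_coherent st_symmon.
Proof.
split=> /=; try by [].
- move=> A B C E; apply: (@peq_refl _ (Cell2 (id2 (b (A @ B @ C) E)))).
    by rewrite st_one -st_beta_hexl pvcomp1l.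
  by rewrite st_one -st_beta_hexl (st_assoc0 H A B C) pvcomp1l.
- move=> A B C E; apply: (@peq_refl _ (Cell2 (id2 (b A (B @ C @ E))))).
    by rewrite st_one -st_beta_hexr pvcomp1l.
  by rewrite st_one -st_beta_hexr (st_assoc0 H B C E) pvcomp1l.
- move=> A B C E; apply: (@peq_refl _ (Cell2 (id2 (b (A @ B) (C @ E))))).
    rewrite -st_beta_hexl pvcompA pvcomp1l.
    (* This cell is the interchangor of two braidings, hence an identity. *)
    have -> : [: st_Phi (b A C) (1 (E @ B)) (1 (A @ C)) (b B E) :]
        = (bt A C # o (E @ B)) \* (o (A @ C) # bt B E).
      rewrite st_PhiE st_phi_beta_ls -!st_o -!st_one -pcompE.
      by rewrite phcomp1r phcomp1l pcompE.
    rewrite (st_beta_hexl A B (C @ E)).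
    have E1 := st_beta_hexr A C E; have E2 := st_beta_hexr B C E.
    rewrite (st_R_pcomp B _ _ E1) ?(st_L_pcomp A _ _ E2); auto with paste.
    rewrite !st_one !st_o !st_tensorA !phcompA.
    by apply: vcomp_one; auto 8 with paste.
  by rewrite -st_beta_hexr pvcomp1l.
- move=> A B C; apply: (@peq_refl _ (Cell2 (id2 (b A (C @ B) \o (1 A # b B C))%cell))).
    rewrite st_beta2E st_phi_id_l -!pcompE pvcomp1l pinv_one; auto with paste.
    by rewrite -(st_natr HS) pvcomp1l.
  rewrite st_beta2E st_phi_id_r -!pcompE !pinv_one; auto with paste.
  rewrite (st_natl HS) !pvcomp1l !pcompE st_beta_hexl st_beta_hexr !st_one.
  by rewrite phcompA.
- move=> A B C; apply: (@peq_refl _ (Cell2 (id2 (1 (A @ B @ C))))).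
    by rewrite st_sigmaE -pcompE (st_sym HS) pvcomp1l.
  rewrite !st_sigmaE -!st_one (st_L_id H) (st_R_id H) (st_assoc0 H A C B) phcomp1r.
  by rewrite -pcompE -(st_L_comp H) (st_sym HS) (st_L_id H) (st_assoc0 H A B C) pvcomp1l.
- move=> A B C; apply: (@peq_refl _ (Cell2 (id2 (1 (A @ (B @ C)))))).
    by rewrite st_sigmaE -pcompE (st_sym HS) pvcomp1l.
  rewrite !st_sigmaE -!st_one (st_L_id H) (st_R_id H) -(st_assoc0 H B A C) phcomp1r.
  by rewrite -pcompE -(st_R_comp H) (st_sym HS) (st_R_id H) -(st_assoc0 H A B C) pvcomp1l.
- move=> A B; rewrite !st_sigmaE phcomp1r phcomp1l.
  exact: peq_refl.
Qed.

(** The hexagon for the objects 1, 1, A says that beta_{1,A} is idempotent; being invertible by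
    symmetry, it is an identity. *)
Lemma st_beta_unitl A : bt (one D) A = o A.
Proof.
have E := st_beta_hexl (one D) (one D) A.
rewrite (st_unitl0 H) st_unitl st_unitr in E.
have := f_equal (phcomp (bt A (one D))) E; rewrite -phcompA st_beta_sym.
have E1 : o (one D @ A) = o A by rewrite (st_unitl0 H).
have E2 : o (A @ one D) = o A by rewrite (st_unitr0 H).
by rewrite E1 -E2 phcomp1l.
Qed.

Lemma st_beta_unitr A : bt A (one D) = o A.
Proof.
have := st_beta_sym A (one D); rewrite st_beta_unitl.
have E1 : o (one D @ A) = o A by rewrite (st_unitl0 H).
have E2 : o (A @ one D) = o A by rewrite (st_unitr0 H).
by rewrite -E1 phcomp1l E1 E2.
Qed.

Lemma st_quasistrict : is_quasistrict st_symmon.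
Proof.
split=> //=.
- split=> /=.
  + split.
    * exact: st_gray_monoid.
    * exact: st_braiding.
    * exact: st_modifications.
    * exact: st_coherent.
  + by move=> A; apply: Cell1_of_id; apply: pcell_inj; apply: st_beta_unitl.
  + by move=> A; apply: Cell1_of_id; apply: pcell_inj; apply: st_beta_unitr.
  + by move=> A B; rewrite (st_unitl0 H).
  + by move=> A B; rewrite (st_unitr0 H).
  + by move=> A B; rewrite (st_unitl0 H).
  + by move=> A B; rewrite (st_unitr0 H).
  + by move=> A B; apply: pcell_inj; apply: st_beta_unitr.
  + by move=> A B; apply: pcell_inj; apply: st_beta_unitl.
- by move=> A B; apply: is_identityE (st_sigmaE A B).
- move=> A B B' g; apply: (@is_identityE _ _ _ _ _ _ _ _ (b A B' \o (1 A # g))%cell).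
  by rewrite st_beta2E st_phi_id_l pcompE.
- move=> A A' B f; apply: (@is_identityE _ _ _ _ _ _ _ _ (b A' B \o (f # 1 B))%cell).
  by rewrite st_beta2E st_phi_id_r pcompE.
- by move=> *; apply: st_Phi_identity; apply: (st_phi_betal HS).
- by move=> *; apply: st_Phi_identity; apply: (st_phi_betar HS).
Qed.

End StringentMonoidal.

(** * From quasistrict to stringent data *)

Section Quasistrict.

Context {M : TwoCat} (Q : symmon_data M) (HQ : is_quasistrict Q).
Implicit Types (A B C : M) (p q r x y z : paste M) (c d : cell2 M).

Local Notation MP := (twocatP M).
Local Notation "A @ B" := (F0 Q A B) (at level 38, left associativity).
Local Notation "f # g" := (F1 Q f g) (at level 38, left associativity)
  : cell_scope.
Local Notation "x # y" := (ptensor Q x y) : paste_scope.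
Local Notation "1" := id1 : cell_scope.
Local Notation o A := ([1 id1 A]).
Local Notation b := (beta Q).
Local Notation bt A B := ([1 b A B]).
Local Notation P f' g' f g := ([: Phi Q f' g' f g :]).

Let HS := crans_sgm (qs_crans HQ).
Let HG := sgm_gray HS.
Let HC := gray_cubical HG.
Let HP := cubical_pf HC.

(** * The tensor product and the coherence cells of a quasistrict structure *)

Lemma qs_tensor_id2 : tensor_id2 Q.
Proof. by move=> *; apply: (pf_id2 HP). Qed.

Local Hint Resolve qs_tensor_id2 : paste.

Lemma qs_one A A' B B' (f : hom A A') (g : hom B B') : [1 f # g] = [1 f] # [1 g].
Proof. by rewrite ptensor_one //; auto with paste. Qed.

(** An identity 2-morphism has equal source and target, so cubicality yields equations between
    1-morphisms. *)
Lemma qs_compl A A' B B' B'' (f : hom A A') (g : hom B B') (g' : hom B' B'') :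
  ((1 A' # g') \o (f # g))%cell = (f # (g' \o g))%cell.
Proof. by have [_ ->] := identityE (cubical_l HC g' f g); rewrite (comp_idl MP). Qed.

Lemma qs_compr A A' A'' B B' (f : hom A A') (f' : hom A' A'') (g : hom B B') :
  ((f' # g) \o (f # 1 B))%cell = ((f' \o f) # g)%cell.
Proof. by have [_ ->] := identityE (cubical_r HC f' g f); rewrite (comp_idr MP). Qed.

Lemma qs_nudge A A' B B' (f : hom A A') (g : hom B B') :
  ((1 A' # g) \o (f # 1 B))%cell = (f # g)%cell.
Proof. by rewrite qs_compl (comp_idr MP). Qed.

Lemma qs_assoc A A' A'' A''' B B' B'' B'''
    (f'' : hom A'' A''') (g'' : hom B'' B''') (f' : hom A' A'')
    (g' : hom B' B'') (f : hom A A') (g : hom B B') :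
  P (f'' \o f')%cell (g'' \o g')%cell f g \v (P f'' g'' f' g' \* [1 f # g])
  = P f'' g'' (f' \o f)%cell (g' \o g)%cell \v ([1 f'' # g''] \* P f' g' f g).
Proof. by rewrite -!phcompE -!pvcompE (pf_assoc HP). Qed.

(** Rewriting an argument of Phi changes its type; for bundled cells the substitution can be made in
    one stroke. *)
Lemma qs_Phi_congr A A' A'' B B' B'' (f1' f2' : hom A' A'') (g1' g2' : hom B' B'')
    (f1 f2 : hom A A') (g1 g2 : hom B B') :
  f1' = f2' -> g1' = g2' -> f1 = f2 -> g1 = g2 -> P f1' g1' f1 g1 = P f2' g2' f2 g2.
Proof. by move=> -> -> -> ->. Qed.

(** Associativity of Phi for (1, g'), (f', 1), (f, g), where two of the four cells are identities by
    cubicality. *)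
Lemma qs_Phi_post A A' A'' B B' B''
    (f' : hom A' A'') (g' : hom B' B'') (f : hom A A') (g : hom B B') :
  P f' g' f g = [1 1 A'' # g'] \* P f' (1 B') f g.
Proof.
have := qs_assoc (1 A'') g' f' (1 B') f g.
rewrite (identity_tgt (cubical_r HC _ _ _)) -pcompE pvcomp1r.
have [-> _] := identityE (cubical_l HC g' (f' \o f)%cell (1 B' \o g)%cell).
by rewrite -phcompE pvcomp1l (comp_idl MP) (comp_idr MP) => ->.
Qed.

(** Associativity of Phi for (f', 1), (1, g), (f, 1), again with two cells equal to identities. *)
Lemma qs_Phi_pre A A' A'' B B' (f' : hom A' A'') (f : hom A A') (g : hom B B') :
  P f' (1 B') f g = P f' (1 B') (1 A') g \* [1 f # 1 B].
Proof.
have := qs_assoc f' (1 B') (1 A') g f (1 B).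
rewrite (identity_tgt (cubical_l HC _ _ _)) -pcompE pvcomp1r.
have [-> _] := identityE (cubical_r HC (f' \o 1 A')%cell (1 B' \o g)%cell f).
by rewrite -phcompE pvcomp1l (comp_idl MP f) (comp_idr MP g) => ->.
Qed.

Lemma qs_PhiE A A' A'' B B' B''
    (f' : hom A' A'') (g' : hom B' B'') (f : hom A A') (g : hom B B') :
  P f' g' f g = [1 1 A'' # g'] \* (P f' (1 B') (1 A') g \* [1 f # 1 B]).
Proof. by rewrite qs_Phi_post qs_Phi_pre. Qed.

(** Naturality of Phi between two of its components that are identities says that the tensor product
    strictly preserves this horizontal composite. *)
Lemma qs_tensor_hcomp A A' A'' B B' B''
    (f' k' : hom A' A'') (g' l' : hom B' B'') (f k : hom A A') (g l : hom B B')
    (a' : hom2 f' k') (c' : hom2 g' l') (a : hom2 f k) (c : hom2 g l) :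
  is_identity (Cell2 (Phi Q k' l' k l)) -> is_identity (Cell2 (Phi Q f' g' f g)) ->
  ([: a' :] # [: c' :]) \* ([: a :] # [: c :]) = [: a' \* a :] # [: c' \* c :].
Proof.
move=> /identityE [E1 _] /identity_tgt E2.
have := f_equal (fun w => [: w :]) (pf_nat HP a' c' a c).
by rewrite !pvcompE {}E1 {}E2 -!ptensorE -phcompE pvcomp1l pvcomp1r.
Qed.

Lemma qs_tensor_nudge A A' B B' (f f' : hom A A') (g g' : hom B B')
    (a : hom2 f f') (c : hom2 g g') :
  [: a :] # [: c :] = (o A' # [: c :]) \* ([: a :] # o B).
Proof.
rewrite qs_tensor_hcomp; [by apply: (cubical_l HC)..|].
by rewrite !phcompE phcomp1l phcomp1r.
Qed.

Lemma qs_assocPhi A A' A'' B B' B'' C C' C''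
    (f' : hom A' A'') (g' : hom B' B'') (h' : hom C' C'')
    (f : hom A A') (g : hom B B') (h : hom C C') :
  (P f' g' f g # [1 h' \o h]) \v P (f' # g')%cell h' (f # g)%cell h
  = ([1 f' \o f] # P g' h' g h) \v P f' (g' # h')%cell f (g # h)%cell.
Proof. by rewrite -!ptensorE -!pvcompE (gray_assocPhi HG). Qed.

(** * The stringent axioms *)

Lemma qs_stringent_monoidal : is_stringent_monoidal (restrict Q).
Proof.
split=> /=.
- exact: (gray_assoc0 HG).
- exact: (gray_unitl0 HG).
- exact: (gray_unitr0 HG).
- exact: (pf_id HP).
- by move=> *; rewrite qs_compl.
- by move=> *; rewrite (pf_id2 HP).
- by move=> A *; rewrite -{1}[id2 (1 A)](vcomp_idl MP) (pf_vcomp HP).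
- move=> A X Y Z g g' f f' c a; apply: pcell_inj.
  rewrite phcompE !ptensorE qs_tensor_hcomp; [by apply: (cubical_l HC)..|].
  by rewrite (hcomp_id MP) (comp_idl MP).
- by move=> *; rewrite (pf_id HP).
- by move=> *; rewrite qs_compr.
- by move=> *; rewrite (pf_id2 HP).
- by move=> A *; rewrite -{1}[id2 (1 A)](vcomp_idl MP) (pf_vcomp HP).
- move=> A X Y Z g g' f f' c a; apply: pcell_inj.
  rewrite phcompE !ptensorE qs_tensor_hcomp; [by apply: (cubical_r HC)..|].
  by rewrite (hcomp_id MP) (comp_idl MP).
- by move=> A B X Y f; rewrite -(gray_assoc1 HG) (pf_id HP).
- by move=> A B X Y f g a; rewrite -(gray_assoc2 HG) (pf_id2 HP) (pf_id HP).
- by move=> A B X Y f; rewrite (gray_assoc1 HG) (pf_id HP).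
- by move=> A B X Y f g a; rewrite (gray_assoc2 HG) (pf_id2 HP) (pf_id HP).
- by move=> A B X Y f; rewrite (gray_assoc1 HG).
- by move=> A B X Y f g a; rewrite (gray_assoc2 HG).
- exact: (gray_unitl1 HG).
- exact: (gray_unitl2 HG).
- exact: (gray_unitr1 HG).
- exact: (gray_unitr2 HG).
- by [].
- by move=> A A' B B' f g; rewrite /tgt /= (comp_idl MP) (comp_idr MP) qs_nudge.
- by move=> *; apply: (pf_iso HP).
- by move=> *; apply: qs_nudge.
- move=> A A' B B' f f' g g' a c; apply: pcell_inj.
  by rewrite phcompE !ptensorE -qs_tensor_nudge.
- move=> A B B' C C' g h; apply: pcell_inj; rewrite /ctensor /= ptensorE.
  (* The three compatibilities of phi with the tensor product are instances of the associativity of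
     Phi in which one 1-morphism is an identity in each slot; cubicality removes all cells but the
     two compared. *)
  have := qs_assocPhi (1 A) g (1 C') (1 A) (1 B) h.
  have [-> _] := identityE (cubical_l HC g (1 A) (1 B)).
  rewrite (identity_tgt (cubical_l HC _ _ _)) -qs_one pvcomp1l -ptensorE pvcomp1r.
  by rewrite (pf_id HP) (comp_idl MP (1 A)) ptensorE.
- move=> A A' B C C' f h; apply: pcell_inj.
  have := qs_assocPhi f (1 B) (1 C') (1 A) (1 B) h.
  have [-> _] := identityE (cubical_r HC f (1 B) (1 A)).
  have [-> _] := identityE (cubical_l HC (1 C') (1 B) h).
  by rewrite -!qs_one !pvcomp1l !(pf_id HP).
- move=> A A' B B' C f g; apply: pcell_inj; rewrite /ctensor /= ptensorE.
  have := qs_assocPhi f (1 B') (1 C) (1 A) g (1 C).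
  have [-> _] := identityE (cubical_l HC (1 C) g (1 C)).
  rewrite (identity_tgt (cubical_r HC _ _ _)) -qs_one pvcomp1l -ptensorE pvcomp1r.
  by rewrite (pf_id HP) (comp_idl MP (1 C)) ptensorE => ->.
- by move=> *; apply: (cubical_r HC).
- by move=> *; apply: (cubical_l HC).
- move=> A A' B B' f f' g a.
  (* Naturality of phi in one variable is naturality of Phi with identity 2-morphisms in the other
     three places. *)
  have := f_equal (fun w => [: w :]) (pf_nat HP a (id2 (1 B')) (id2 (1 A)) (id2 g)).
  rewrite !pvcompE phcompE (pf_id2 HP) !ptensorE !(phcompE a) !(phcompE (id2 (1 B'))).
  rewrite phcomp1r phcomp1l (qs_tensor_nudge a (id2 g)) -!qs_one => <-.
  rewrite -ptensorE -phcompE -pvcompE; exact: peq_refl.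
- move=> A A' B B' f g g' c.
  have := f_equal (fun w => [: w :]) (pf_nat HP (id2 f) (id2 (1 B')) (id2 (1 A)) c).
  rewrite !pvcompE phcompE (pf_id2 HP) !ptensorE !phcompE.
  rewrite phcomp1r phcomp1l (qs_tensor_nudge (id2 f) c) -!qs_one => <-.
  rewrite -ptensorE -phcompE -pvcompE; exact: peq_refl.
- move=> A A' B B' B'' f g g'.
  apply: (@peq_refl _ (Cell2 (Phi Q f (1 B'') (1 A) (g' \o g)%cell))) => //.
  (* Associativity of Phi for (f, 1), (1, g'), (1, g): the cell of the last two is an identity, and
     Phi_{(f,g'),(1,g)} is phi_{f,g} whiskered by [g']. *)
  have := qs_assoc f (1 B'') (1 A) g' (1 A) g.
  rewrite (identity_tgt (cubical_l HC g' (1 A) g)) -pcompE pvcomp1r.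
  rewrite (comp_idl MP (1 A)) => <-.
  rewrite (qs_Phi_congr (comp_idr MP f) (comp_idl MP g') eq_refl eq_refl).
  by rewrite (qs_PhiE f g' (1 A) g) (pf_id HP) phcomp1r.
- move=> A A' A'' B B' f f' g.
  apply: (@peq_refl _ (Cell2 (Phi Q (f' \o f)%cell (1 B') (1 A) g))) => //.
  have := qs_assoc f' (1 B') f (1 B') (1 A) g.
  rewrite (identity_tgt (cubical_r HC f' (1 B') f)) -pcompE pvcomp1r.
  rewrite (comp_idl MP (1 B')) => ->.
  rewrite (qs_Phi_congr eq_refl eq_refl (comp_idr MP f) (comp_idl MP g)).
  by rewrite (qs_Phi_pre f' f g).
Qed.

Lemma qs_natl A A' B (f : hom A A') :
  (b A' B \o (f # 1 B) = (1 B # f) \o b A B)%cell.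
Proof. by have [_ ->] := identityE (qs2_r HQ B f). Qed.

Lemma qs_natr A B B' (g : hom B B') :
  (b A B' \o (1 A # g) = (g # 1 A) \o b A B)%cell.
Proof. by have [_ ->] := identityE (qs2_l HQ A g). Qed.

Lemma qs_sym A B : (b B A \o b A B)%cell = 1 (A @ B).
Proof. by have [_ ->] := identityE (qs1_sigma HQ A B). Qed.

Lemma qs_stringent_symmetric : is_stringent_symmetric (restrict Q).
Proof.
split=> /=.
- exact: qs_stringent_monoidal.
- exact: qs_sym.
(* As R is an identity, its target, the composite of braidings, equals its source, the braiding of
   [A @ B] with [C]. *)
- move=> A B C; have := R_tgt (sgm_mod HS) A B C.
  by rewrite -(R_src (sgm_mod HS)) {1}(qs1_R HQ A B C).
- move=> A B C; have := S_tgt (sgm_mod HS) A B C.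
  by rewrite -(S_src (sgm_mod HS)) {1}(qs1_S HQ A B C).
- by move=> *; apply: qs_natl.
- by move=> *; apply: qs_natr.
- by move=> *; apply: (qs3_r HQ).
- by move=> *; apply: (qs3_l HQ).
Qed.

(** * The components of the braiding in terms of the interchangors *)

Lemma qs_beta2_comp A A' A'' B B' B''
  (f' : hom A' A'') (g' : hom B' B'') (f : hom A A') (g : hom B B') :
  [: beta2 Q (f' \o f) (g' \o g) :] \v (P g' f' g f \* bt A B)
  = (bt A'' B'' \* P f' g' f g) \v ([: beta2 Q f' g' :] \* [1 f # g])
    \v ([1 g' # f'] \* [: beta2 Q f g :]).
Proof.
by apply: peqE (beta2_comp (sgm_beta HS) f' g' f g); auto 7 with paste.
Qed.

Lemma qs_beta2E A A' B B' (f : hom A A') (g : hom B B') :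
  [: beta2 Q f g :] = bt A' B' \* P f (1 B') (1 A) g.
Proof.
have := qs_beta2_comp f (1 B') (1 A) g.
rewrite (identity_tgt (cubical_l HC f g (1 A))) -pcompE pvcomp1r.
(* By (QS.2) the components of the braiding at (1, g) and (f, 1) are identities, leaving only the
   whiskered interchangor. *)
rewrite (identity_tgt (qs2_l HQ A g)) (identity_tgt (qs2_r HQ B' f)).
rewrite -!pcompE (comp_assoc MP (1 B' # f)%cell) -qs_natl pvcompA pvcomp1l.
rewrite -(comp_assoc MP) -phcompE pvcomp1r => <-.
by rewrite (comp_idl MP) (comp_idr MP).
Qed.

Lemma qs_phi_beta_inv A A' B B' (f : hom A A') (g : hom B B') :
  [1 b A' B' \o ((1 A' # g) \o (f # 1 B))]
  = (bt A' B' \* P f (1 B') (1 A) g) \v (P g (1 A') (1 B) f \* bt A B).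
Proof.
have := qs_beta2_comp (1 A') g f (1 B).
have [-> _] := identityE (cubical_l HC g f (1 B)).
rewrite (identity_tgt (qs2_l HQ A' g)) (identity_tgt (qs2_r HQ B f)).
rewrite -!pcompE !(comp_assoc MP) -qs_natr !pvcomp1l => <-.
have -> : [: beta2 Q (1 A' \o f) (g \o 1 B) :] = [: beta2 Q f g :].
  by rewrite (comp_idl MP) (comp_idr MP).
by rewrite qs_beta2E.
Qed.

Lemma qs_braiding_natural : is_braiding_natural (restrict Q).
Proof.
split=> /=.
- move=> A A' B f f' a; apply: pcell_inj.
  have := f_equal (fun w => [: w :]) (beta2_nat (sgm_beta HS) a (id2 (1 B))).
  rewrite !pvcompE (identity_tgt (qs2_r HQ B f)).
  have [-> _] := identityE (qs2_r HQ B f').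
  by rewrite pvcomp1l pvcomp1r.
- move=> A B B' g g' c; apply: pcell_inj.
  have := f_equal (fun w => [: w :]) (beta2_nat (sgm_beta HS) (id2 (1 A)) c).
  rewrite !pvcompE (identity_tgt (qs2_l HQ A g)).
  have [-> _] := identityE (qs2_l HQ A g').
  by rewrite pvcomp1l pvcomp1r.
- move=> A A' B B' f g.
  apply: (@peq_refl _ (Cell2 (id2 (b A' B' \o (f # 1 B') \o (1 A # g))%cell))); last first.
    by rewrite -!pcompE.
  (* Whiskering this relation on both sides with braidings cancels those already present and moves
     the remaining ones to where they are wanted. *)
  have E := qs_phi_beta_inv g f.
  have S X Y : bt X Y \* bt Y X = o (Y @ X) by rewrite -pcompE qs_sym.
  have := whisker (k := bt A' B') (m := bt A B) _ _ _ _ E.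
  rewrite !phcompA S -phcompE phcomp1r -!(phcompA _ (bt B' A') (bt A' B')) S.
  rewrite -(phcompA _ _ (o _)) phcomp1l => <-; auto with paste.
  rewrite -!pcompE !(comp_assoc MP) qs_sym (comp_idl MP) -(comp_assoc MP (1 B' # f)%cell).
  by rewrite -qs_natr !(comp_assoc MP) -qs_natl.
Qed.

End Quasistrict.

(** * The two constructions are mutually inverse *)

(** Both records share the tensor product and the braiding, on which the types of the other fields
    depend, so those fields can be compared pointwise. *)
Lemma symmon_data_ext (M : twocat_data) (T : tensor_data M) (Phi Phi' : bifun_coherence T)
    (be : forall A B : M, hom (F0 T A B) (F0 T B A)) b2 b2' R R' S S' si si' :
  (forall A A' A'' B B' B'' f' g' f g,
     Phi A A' A'' B B' B'' f' g' f g = Phi' A A' A'' B B' B'' f' g' f g) ->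
  (forall A A' B B' f g, b2 A A' B B' f g = b2' A A' B B' f g) ->
  (forall A B C, R A B C = R' A B C) -> (forall A B C, S A B C = S' A B C) ->
  (forall A B, si A B = si' A B) ->
  @SymmonData M T Phi be b2 R S si = @SymmonData M T Phi' be b2' R' S' si'.
Proof.
move=> E1 E2 E3 E4 E5.
have -> : Phi = Phi' by do 10 (apply: functional_extensionality_dep => ?).
have -> : b2 = b2' by do 6 (apply: functional_extensionality_dep => ?).
have -> : R = R' by do 3 (apply: functional_extensionality_dep => ?).
have -> : S = S' by do 3 (apply: functional_extensionality_dep => ?).
by have -> : si = si' by do 2 (apply: functional_extensionality_dep => ?).
Qed.

Lemma restrict_st_symmon (M : TwoCat) (D : stringent_data M)
    (H : is_stringent_monoidal D) (HS : is_stringent_symmetric D) :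
  restrict (st_symmon H HS) = D.
Proof.
rewrite /restrict /=.
have -> : (fun A A' B B' f g => Cell2 (st_Phi H f (id1 B') (id1 A) g))
    = (fun A A' B B' => @phi M D A A' B B').
  do 6 (apply: functional_extensionality_dep => ?); apply: pcell_inj.
  (* At (f, 1), (1, g) the two whiskerings are by identities, which returns the original phi. *)
  by rewrite st_PhiE -!(st_o H) phcomp1r phcomp1l st_phiE.
by case: (D).
Qed.

Lemma st_symmon_restrict (M : TwoCat) (Q : symmon_data M) (HQ : is_quasistrict Q)
    (H : is_stringent_monoidal (restrict Q)) (HS : is_stringent_symmetric (restrict Q)) :
  st_symmon H HS = Q.
Proof.
(* Destructing [Q] exposes the common tensor product and braiding, as extensionality requires. *)
move: (HQ) H HS; case: Q HQ => T Phi be b2 R S si HQ _ H HS.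
have HM := sgm_mod (crans_sgm (qs_crans HQ)); apply: symmon_data_ext.
- move=> A A' A'' B B' B'' f' g' f g; apply: Cell2_inj; apply: pcell_inj.
  rewrite [RHS](qs_PhiE HQ) [LHS](st_PhiE H) (st_phiE H).
  by rewrite !(qs_one HQ).
- move=> A A' B B' f g; apply: Cell2_inj; apply: pcell_inj.
  by rewrite [RHS](qs_beta2E HQ) [LHS](st_beta2E H HS) (st_phiE H).
- move=> A B C; rewrite [RHS](qs1_R HQ A B C).
  by apply: Cell2_id; rewrite -(R_src HM).
- move=> A B C; rewrite [RHS](qs1_S HQ A B C).
  by apply: Cell2_id; rewrite -(S_src HM).
- move=> A B; apply: Cell2_inj; apply: pcell_inj.
  by rewrite [LHS](st_sigmaE H HS) [in RHS](qs1_sigma HQ A B).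
Qed.

Theorem proposition13 (M : TwoCat) :
  exists (F : {Q : symmon_data M | is_quasistrict Q} ->
              {D : stringent_data M |
                is_stringent_symmetric D /\ is_braiding_natural D})
         (G : {D : stringent_data M |
                is_stringent_symmetric D /\ is_braiding_natural D} ->
              {Q : symmon_data M | is_quasistrict Q}),
    (forall Q, proj1_sig (F Q) = restrict (proj1_sig Q)) /\
    (forall D, restrict (proj1_sig (G D)) = proj1_sig D) /\
    (forall Q, G (F Q) = Q) /\
    (forall D, F (G D) = D).
Proof.
exists (fun Q => exist _ (restrict (proj1_sig Q))
  (conj (qs_stringent_symmetric (proj2_sig Q)) (qs_braiding_natural (proj2_sig Q)))).
exists (fun D => let: conj HS HN := proj2_sig D in
  exist _ (st_symmon (st_monoidal HS) HS) (st_quasistrict (st_monoidal HS) HS HN)).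
split; [by []|split; [|split]].
- by move=> [D [HS HN]] /=; apply: restrict_st_symmon.
(* By proof irrelevance, equality in the subtype reduces to equality of the underlying data. *)
- by move=> [Q HQ] /=; apply: subset_eq_compat; apply: st_symmon_restrict.
- by move=> [D [HS HN]] /=; apply: subset_eq_compat; apply: restrict_st_symmon.
Qed.
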